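(* The following decision problem ($h$-AllKEI) can be solved in polynomial time (for the general model, i.e. with no restriction on the sets $I_i$): given an instance $(R,D,C,H,I)$ and an integer $h$, decide whether there is a feasible allocation in which every recipient of $R_1\cup R_2$ receives a transplant (i.e. is matched along a compatible or half-compatible edge) and at most $h$ recipients receive a half-compatible transplant (i.e. use immunosuppressants).
   Context: An instance $(R,D,C,H,I)$ consists of a finite set $R$ of recipients and a finite set $D$ of donors. $R=R_1\cup R_2$ (disjoint) and $D=D_1\cup D_2$ (disjoint), where recipients in $R_2$ and donors in $D_2$ come in pairs $(r_i,d_i)$ sharing an index $i$; recipients in $R_1$ have no donor, and donors in $D_1$ are altruistic donors. For each recipient $r_i$, $D$ is partitioned into $C_i$ (compatible donors), $H_i$ (half-compatible donors: usable only if $r_i$ gets an immunosuppressant) and $I_i$ (incompatible donors). Associated bipartite graph $G$: one side is $R$ together with a set $R_0$ containing one dummy recipient $r_j$ for each $d_j\in D_1$; the other side is $D$ together with a set $D_0$ containing one dummy donor $d_j$ for each $r_j\in R_1$. Edges (parallel edges allowed): a private edge $r_id_i$ for every index $i$; dummy edges joining each dummy recipient in $R_0$ to every vertex of $D\cup D_0$; a compatible edge $r_jd$ for each $r_j\in R$ and $d\in C_j$; a half-compatible edge $r_jd$ for each $r_j\in R$ and $d\in H_j$. A feasible allocation is a perfect matching of $G$; a recipient matched along a compatible edge gets a compatible transplant, along a half-compatible edge a half-compatible transplant with an immunosuppressant, and private/dummy edges mean no transplant. *)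

(* Defs.v *)
From mathcomp Require Import all_boot all_order all_algebra.
Set Implicit Arguments. Unset Strict Implicit. Unset Printing Implicit Defensive.

(*    Alphabet 'I_(nG.+3): symbol 0 is the blank, symbols 1 and 2 are   *)
(*    the input bits false / true.                                      *)

Inductive move := MoveL | MoveR | Stay.

Record TM := {
  nQ : nat;
  nG : nat;
  delta : 'I_nQ.+1 -> 'I_nG.+3 -> 'I_nQ.+1 * 'I_nG.+3 * move;
  q_start : 'I_nQ.+1;
  q_acc : 'I_nQ.+1;
  q_rej : 'I_nQ.+1
}.

(* configuration: state, tape left of head (nearest cell first), scanned
   cell, tape right of head (nearest cell first) *)
Record config (M : TM) := Config {
  c_state : 'I_(nQ M).+1;
  c_left : seq 'I_(nG M).+3;
  c_cur : 'I_(nG M).+3;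
  c_right : seq 'I_(nG M).+3
}.

Definition blank (M : TM) : 'I_(nG M).+3 := ord0.
Definition bit_sym (M : TM) (b : bool) : 'I_(nG M).+3 := inord (1 + b).

Definition halted (M : TM) (c : config M) : bool :=
  (c_state c == q_acc M) || (c_state c == q_rej M).

Definition tm_step (M : TM) (c : config M) : config M :=
  if halted c then c else
  let: (q', s', mv) := delta (c_state c) (c_cur c) in
  match mv with
  | Stay => Config q' (c_left c) s' (c_right c)
  | MoveL => match c_left c with
             | [::] => Config q' [::] (blank M) (s' :: c_right c)
             | a :: l => Config q' l a (s' :: c_right c)
             end
  | MoveR => match c_right c with
             | [::] => Config q' (s' :: c_left c) (blank M) [::]
             | a :: r => Config q' (s' :: c_left c) a r
             end
  end.

Definition tm_init (M : TM) (x : seq bool) : config M :=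
  match x with
  | [::] => Config (q_start M) [::] (blank M) [::]
  | b :: x' => Config (q_start M) [::] (bit_sym M b) (map (bit_sym M) x')
  end.

Definition tm_run (M : TM) (t : nat) (x : seq bool) : config M :=
  iter t (@tm_step M) (tm_init M x).

Definition poly_time_decidable (L : seq bool -> Prop) : Prop :=
  exists (M : TM) (c k : nat),
    q_acc M != q_rej M /\
    forall x : seq bool, exists t : nat,
      t <= c * (size x) ^ k + c /\
      halted (tm_run M t x) /\
      (c_state (tm_run M t x) = q_acc M <-> L x).

(*    np = |R2| = |D2| (pairs (r_i,d_i), i < np),                       *)
(*    na = |R1| (recipients without donor), nb = |D1| (altruistic).     *)

Inductive compat := Comp | HalfComp | Incomp.

Notation recipient p a := ('I_p + 'I_a)%type.   (* R2 + R1 *)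
Notation donor p b := ('I_p + 'I_b)%type.       (* D2 + D1 *)

Record instance := Instance {
  np : nat; na : nat; nb : nat;
  (* st r d = Comp iff d \in C_r, HalfComp iff d \in H_r, Incomp iff d \in I_r *)
  st : recipient np na -> donor np nb -> compat
}.

(* left side: R together with R0 (one dummy recipient per d_j in D1) *)
Notation gleft I := (recipient (np I) (na I) + 'I_(nb I))%type.
(* right side: D together with D0 (one dummy donor per r_j in R1) *)
Notation gright I := (donor (np I) (nb I) + 'I_(na I))%type.

Inductive ekind := Private | Dummy | CompE | HalfE.

(* edge u v of kind k exists in G (parallel edges of distinct kinds allowed) *)
Definition gedge (I : instance) (k : ekind) (u : gleft I) (v : gright I) : bool :=
  match k, u, v with
  | Private, inl (inl i), inl (inl i') => i == i'    (* r_i d_i, pairs *)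
  | Private, inl (inr j), inr j' => j == j'          (* r_j in R1, dummy d_j in D0 *)
  | Private, inr j, inl (inr j') => j == j'          (* dummy r_j in R0, d_j in D1 *)
  | Private, _, _ => false
  | Dummy, inr _, _ => true                          (* R0 to all of D u D0 *)
  | Dummy, _, _ => false
  | CompE, inl r, inl d => if st r d is Comp then true else false
  | CompE, _, _ => false
  | HalfE, inl r, inl d => if st r d is HalfComp then true else false
  | HalfE, _, _ => false
  end.

Definition perfect_matching (I : instance) (m : gleft I -> gright I * ekind) : Prop :=
  (forall u, gedge (m u).2 u (m u).1) /\ bijective (fun u => (m u).1).

Definition allKEI_yes (I : instance) (h : int) : Prop :=
  exists m : gleft I -> gright I * ekind,
    perfect_matching m /\
    (forall r : recipient (np I) (na I),
        (m (inl r)).2 = CompE \/ (m (inl r)).2 = HalfE) /\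
    ((#|[set r : recipient (np I) (na I) | if (m (inl r)).2 is HalfE then true else false]| : int) <= h)%R.

Definition unary (n : nat) : seq bool := nseq n true ++ [:: false].

Fixpoint bitsF (fuel n : nat) : seq bool :=
  match fuel with
  | 0 => [::]
  | fuel'.+1 => if n == 0 then [::] else odd n :: bitsF fuel' n./2
  end.
Definition bin (n : nat) : seq bool := bitsF n n.

Definition enc_int (h : int) : seq bool :=
  match h with
  | Posz n => false :: bin n
  | Negz n => true :: bin n       (* Negz n = -(n+1) *)
  end.

Definition enc_compat (c : compat) : seq bool :=
  match c with Comp => [:: false; false] | HalfComp => [:: false; true]
             | Incomp => [:: true; false] end.

Definition enc (I : instance) (h : int) : seq bool :=
  unary (np I) ++ unary (na I) ++ unary (nb I) ++
  flatten [seq flatten [seq enc_compat (st r d) | d <- enum [set: donor (np I) (nb I)]]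
          | r <- enum [set: recipient (np I) (na I)]] ++
  enc_int h.

Definition allKEI_lang (x : seq bool) : Prop :=
  exists (I : instance) (h : int), x = enc I h /\ allKEI_yes I h.

(* Main.v *)
Require Import Defs.
From mathcomp Require Import all_boot all_order all_algebra.
From mathcomp Require Import zify.
Set Implicit Arguments. Unset Strict Implicit. Unset Printing Implicit Defensive.

(** Dummy recipients can absorb every unused donor, so an instance is a
    yes-instance iff some injection from recipients to donors avoids the
    incompatible pairs and uses at most [h] half-compatible ones.  With [a]
    recipients, give compatible, half-compatible and incompatible pairs the costs
    [0], [a + 1] and [(a + 1)^2].  In Bertsekas' auction an unassigned recipient
    takes the donor minimising cost plus price, evicting the previous holder, and
    raises the price of that donor by one.  A donor never bid for is free, so
    prices stay at most [(a + 1)^2 + 1] and the auction stops after polynomially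
    many bids; every recipient is then within one unit of its best choice, so the
    assignment is within [a] of the optimum, hence optimal since costs are
    multiples of [a + 1].

    The auction is written in a language of counters, bit arrays and bounded
    loops.  On the tape a counter is a mark at the position given by its value, so
    that each elementary instruction is a single left-to-right pass of a finite
    transducer. *)

Record store := Store { rg : nat -> nat; ar : nat -> nat -> bool }.

Definition upd T (f : nat -> T) (k : nat) (v : T) : nat -> T :=
  fun i => if i == k then v else f i.

Inductive op :=
  | Zr of nat
  | Inc of nat
  | Mov of nat & nat
  | Wr of nat & nat & bool.

Inductive test := Eq of nat & nat | Lt of nat & nat | Rd of nat & nat.

Inductive cmd :=
  | Skip
  | Op of op
  | Seq of cmd & cmd
  | If of test & cmd & cmd
  | For of nat & nat & cmd.

Definition setr (s : store) r v := Store (upd (rg s) r v) (ar s).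
Definition seta (s : store) A i b :=
  Store (rg s) (upd (ar s) A (upd (ar s A) i b)).

Definition run_op (o : op) (s : store) : store :=
  match o with
  | Zr r => setr s r 0
  | Inc r => setr s r (rg s r).+1
  | Mov r q => setr s r (rg s q)
  | Wr A r b => seta s A (rg s r) b
  end.

Definition run_test (t : test) (s : store) : bool :=
  match t with
  | Eq r q => rg s r == rg s q
  | Lt r q => rg s r < rg s q
  | Rd A r => ar s A (rg s r)
  end.

Fixpoint exec (c : cmd) (s : store) : store :=
  match c with
  | Skip => s
  | Op o => run_op o s
  | Seq c1 c2 => exec c2 (exec c1 s)
  | If t c1 c2 => if run_test t s then exec c1 s else exec c2 s
  | For p q c1 =>
      iter (rg s q) (fun s' => run_op (Inc p) (exec c1 s')) (run_op (Zr p) s)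
  end.

Definition op_mods (o : op) : seq nat :=
  match o with Zr r | Inc r | Mov r _ => [:: r] | Wr _ _ _ => [::] end.

Fixpoint reg_mods (c : cmd) : seq nat :=
  match c with
  | Skip => [::]
  | Op o => op_mods o
  | Seq c1 c2 | If _ c1 c2 => reg_mods c1 ++ reg_mods c2
  | For p _ c1 => p :: reg_mods c1
  end.

Fixpoint arr_mods (c : cmd) : seq nat :=
  match c with
  | Op (Wr A _ _) => [:: A]
  | Seq c1 c2 | If _ c1 c2 => arr_mods c1 ++ arr_mods c2
  | For _ _ c1 => arr_mods c1
  | _ => [::]
  end.

Lemma exec_frame_reg c s r : r \notin reg_mods c -> rg (exec c s) r = rg s r.
Proof.
elim: c s => [|o|c1 IH1 c2 IH2|t c1 IH1 c2 IH2|p q c IH] s //=.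
- case: o => [a|a|a b|A a b] //=; rewrite ?inE /upd => /negPf -> //.
- by rewrite mem_cat negb_or => /andP[h1 h2]; rewrite IH2 ?IH1.
- by rewrite mem_cat negb_or => /andP[h1 h2]; case: ifP => _; rewrite ?IH2 ?IH1.
- rewrite inE negb_or => /andP[h1 h2].
  elim: (rg s q) => [|n IHn] /=; rewrite /upd (negPf h1) //.
  by rewrite IH.
Qed.

Lemma exec_frame_arr c s A : A \notin arr_mods c -> ar (exec c s) A = ar s A.
Proof.
elim: c s => [|o|c1 IH1 c2 IH2|t c1 IH1 c2 IH2|p q c IH] s //=.
- case: o => [a|a|a b|A' a b] //=; rewrite ?inE /upd => /negPf -> //.
- by rewrite mem_cat negb_or => /andP[h1 h2]; rewrite IH2 ?IH1.
- by rewrite mem_cat negb_or => /andP[h1 h2]; case: ifP => _; rewrite ?IH2 ?IH1.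
- move=> h; elim: (rg s q) => [|n IHn] //=.
  by rewrite IH.
Qed.

(** * Flat code *)

Inductive mop := MInit | MNop | MOp of op | MTest of test.

(* Register 1 holds the length of the input, array 0 its bits, and array 1 marks
   the cells it occupies. *)
Definition init_store (x : seq bool) : store :=
  Store (fun r => if r == 1 then size x else 0)
        (fun A i => if A == 0 then nth false x i else (A == 1) && (i < size x)).

Definition instr : Type := (mop * nat * nat)%type.

Definition mop_run (m : mop) (s : store) : store :=
  if m is MOp o then run_op o s else s.
Definition mop_flag (m : mop) (s : store) : bool :=
  if m is MTest t then run_test t s else false.

Definition ninstr : instr := (MNop, 0, 0).

Definition cstep (code : seq instr) (x : nat * store) : nat * store :=
  let: (m, tT, tF) := nth ninstr code x.1 in
  (if mop_flag m x.2 then tT else tF, mop_run m x.2).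

Fixpoint csize (c : cmd) : nat :=
  match c with
  | Skip | Op _ => 1
  | Seq c1 c2 => csize c1 + csize c2
  | If _ c1 c2 => (csize c1 + csize c2).+2
  | For _ _ c1 => (csize c1).+3
  end.

Fixpoint compile (c : cmd) (pc : nat) : seq instr :=
  match c with
  | Skip => [:: (MNop, pc.+1, pc.+1)]
  | Op o => [:: (MOp o, pc.+1, pc.+1)]
  | Seq c1 c2 => compile c1 pc ++ compile c2 (pc + csize c1)
  | If t c1 c2 =>
      let mid := pc.+1 + csize c1 in
      let fin := mid.+1 + csize c2 in
      (MTest t, pc.+1, mid.+1) :: compile c1 pc.+1 ++
        (MNop, fin, fin) :: compile c2 mid.+1
  | For p q c1 =>
      let fin := pc.+3 + csize c1 in
      [:: (MOp (Zr p), pc.+1, pc.+1), (MTest (Eq p q), fin, pc.+2)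
        & rcons (compile c1 pc.+2) (MOp (Inc p), pc.+1, pc.+1)]
  end.

Lemma size_comp c pc : size (compile c pc) = csize c.
Proof.
elim: c pc => [|o|c1 IH1 c2 IH2|t c1 IH1 c2 IH2|p q c IH] pc //=.
- by rewrite size_cat IH1 IH2.
- by rewrite size_cat /= IH1 IH2 addnS.
- by rewrite size_rcons IH.
Qed.

(* Every loop is bounded by a register of [Q], and no register of [Q] is
   modified: running time is then polynomial in the values of [Q]. *)
Fixpoint bounded (Q : seq nat) (c : cmd) : bool :=
  match c with
  | Skip => true
  | Op o => ~~ has (mem Q) (op_mods o)
  | Seq c1 c2 | If _ c1 c2 => bounded Q c1 && bounded Q c2
  | For p q c1 => [&& q \in Q, p \notin Q, p \notin reg_mods c1 & bounded Q c1]
  end.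

Fixpoint steps (c : cmd) (B : nat) : nat :=
  match c with
  | Skip | Op _ => 1
  | Seq c1 c2 => steps c1 B + steps c2 B
  | If _ c1 c2 => steps c1 B + steps c2 B + 2
  | For _ _ c1 => B * (steps c1 B + 2) + 2
  end.

Lemma bounded_frame Q c q : bounded Q c -> q \in Q -> q \notin reg_mods c.
Proof.
move=> + hq; elim: c => [|o|c1 IH1 c2 IH2|t c1 IH1 c2 IH2|p q' c IH] //=.
- by move=> /hasPn h; apply/negP => /h /=; rewrite hq.
- by case/andP=> /IH1 h1 /IH2 h2; rewrite mem_cat negb_or h1.
- by case/andP=> /IH1 h1 /IH2 h2; rewrite mem_cat negb_or h1.
- case/and4P=> _ hp _ /IH h; rewrite inE negb_or h andbT.
  by apply: contraNneq hp => <-.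
Qed.

Lemma comp_correct Q B c : bounded Q c -> forall pre post s,
  (forall q, q \in Q -> rg s q <= B) ->
  exists2 n, n <= steps c B &
    iter n (cstep (pre ++ compile c (size pre) ++ post)) (size pre, s)
      = (size pre + csize c, exec c s).
Proof.
have nth_at pre (i : instr) post : nth ninstr (pre ++ i :: post) (size pre) = i.
  by rewrite nth_cat ltnn subnn.
elim: c => [|o|c1 IH1 c2 IH2|t c1 IH1 c2 IH2|p q c IH] /= hb pre post s hs.
- by exists 1 => //=; rewrite /cstep /= nth_at /= addn1.
- by exists 1 => //=; rewrite /cstep /= nth_at /= addn1.
- case/andP: hb => hb1 hb2.
  have [n1 hn1 e1] := IH1 hb1 pre (compile c2 (size pre + csize c1) ++ post) s hs.
  have hs2 q : q \in Q -> rg (exec c1 s) q <= B.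
    by move=> hq; rewrite exec_frame_reg ?hs // (bounded_frame hb1).
  have [n2 hn2 e2] := IH2 hb2 (pre ++ compile c1 (size pre)) post _ hs2.
  exists (n2 + n1); first by rewrite addnC leq_add.
  rewrite iterD -catA e1; move: e2.
  by rewrite size_cat size_comp -!catA => ->; rewrite addnA.
- case/andP: hb => hb1 hb2.
  set mid := (size pre).+1 + csize c1.
  set fin := mid.+1 + csize c2.
  set code := (X in cstep X).
  have efin : size pre + (csize c1 + csize c2).+2 = fin.
    by rewrite /fin /mid; lia.
  have first : cstep code (size pre, s) =
     (if run_test t s then (size pre).+1 else mid.+1, s).
    by rewrite /cstep /code /= nth_at.
  case: ifP first => ht first.
    have [n1 hn1] := IH1 hb1 (rcons pre (MTest t, (size pre).+1, mid.+1))
       ((MNop, fin, fin) :: compile c2 mid.+1 ++ post) s hs.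
    rewrite size_rcons cat_rcons => e1.
    exists (1 + (n1 + 1)); first by lia.
    rewrite iterD (iterD n1) /= first.
    have -> : code = pre ++ (MTest t, (size pre).+1, mid.+1) ::
         compile c1 (size pre).+1 ++ (MNop, fin, fin) :: compile c2 mid.+1 ++ post.
      by rewrite /code /= -!catA.
    rewrite e1 /cstep /= -cat_cons catA.
    have -> : (size pre).+1 + csize c1 =
       size (pre ++ (MTest t, (size pre).+1, mid.+1) :: compile c1 (size pre).+1).
      by rewrite size_cat /= size_comp; lia.
    by rewrite nth_at efin.
  have [n2 hn2] := IH2 hb2 (pre ++ (MTest t, (size pre).+1, mid.+1) ::
         compile c1 (size pre).+1 ++ [:: (MNop, fin, fin)]) post s hs.
  have -> : size (pre ++ (MTest t, (size pre).+1, mid.+1) ::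
         compile c1 (size pre).+1 ++ [:: (MNop, fin, fin)]) = mid.+1.
    by rewrite size_cat /= size_cat size_comp /mid /=; lia.
  move=> e2; exists (n2 + 1); first by lia.
  rewrite iterD /= first efin -e2; congr (iter _ (cstep _) _).
  by rewrite /code /= -!catA /= -!catA.
- case/and4P: hb => hq hp hpc hb.
  set fin := (size pre).+3 + csize c.
  set code := (X in cstep X).
  set zr := (MOp (Zr p), (size pre).+1, (size pre).+1) : instr.
  set tst := (MTest (Eq p q), fin, (size pre).+2) : instr.
  set incr := (MOp (Inc p), (size pre).+1, (size pre).+1) : instr.
  have codeE : code = pre ++ [:: zr, tst & compile c (size pre).+2 ++ incr :: post].
    by rewrite /code /= cat_rcons.
  have hqp : q != p by apply: contraNneq hp => <-.
  have st1 s' : cstep code ((size pre).+1, s') =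
      (if rg s' p == rg s' q then fin else (size pre).+2, s').
    rewrite /cstep codeE -cat_rcons.
    have -> : (size pre).+1 = size (rcons pre zr) by rewrite size_rcons.
    by rewrite [X in nth _ _ X]/= nth_at /= size_rcons.
  have body s' : (forall q, q \in Q -> rg s' q <= B) ->
      exists2 n, n <= steps c B + 1 &
        iter n (cstep code) ((size pre).+2, s') =
          ((size pre).+1, run_op (Inc p) (exec c s')).
    move=> hs'.
    have [n hn] := IH hb (rcons (rcons pre zr) tst) (incr :: post) s' hs'.
    rewrite !size_rcons !cat_rcons -codeE => e.
    exists (1 + n); first by lia.
    rewrite iterD e /= /cstep codeE.
    have -> : (size pre).+2 + csize c =
        size (pre ++ [:: zr, tst & compile c (size pre).+2]).
      by rewrite size_cat /= size_comp; lia.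
    rewrite /= -cat_cons -cat_cons catA nth_at //.
  pose F := fun s' => run_op (Inc p) (exec c s').
  have hsF k q' : q' != p -> q' \notin reg_mods c ->
      rg (iter k F (run_op (Zr p) s)) q' = rg s q'.
    move=> h1 h2; elim: k => [|k IHk] /=; rewrite /upd (negPf h1) //.
    by rewrite exec_frame_reg.
  have hpF k : rg (iter k F (run_op (Zr p) s)) p = k.
    elim: k => [|k IHk] /=; rewrite /upd eqxx // exec_frame_reg //.
    by rewrite IHk.
  have hqc : q \notin reg_mods c by apply: bounded_frame hb hq.
  have loop k : k <= rg s q -> exists2 n, n <= k * (steps c B + 2) &
      iter n (cstep code) ((size pre).+1, run_op (Zr p) s) =
        ((size pre).+1, iter k F (run_op (Zr p) s)).
    elim: k => [|k IHk] hk; first by exists 0.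
    have [n hn e] := IHk (ltnW hk).
    have [|n' hn' e'] := body (iter k F (run_op (Zr p) s)).
      move=> q' hq'; rewrite hsF ?hs // ?(bounded_frame hb) //.
      by apply: contraNneq hp => <-.
    exists (n' + (1 + n)); first by rewrite mulSn; lia.
    rewrite iterD (iterD 1) e /= st1 hpF hsF //.
    by rewrite (ltn_eqF hk) e'.
  have [n hn e] := loop _ (leqnn _).
  exists (1 + (n + 1)).
    have : n <= B * (steps c B + 2).
      by apply: leq_trans hn _; rewrite leq_mul2r hs ?orbT.
    by lia.
  rewrite iterD (iterD n).
  have -> : iter 1 (cstep code) (size pre, s) = ((size pre).+1, run_op (Zr p) s).
    by rewrite /= /cstep codeE nth_at.
  rewrite e /= st1 hpF hsF // eqxx.
  by congr (_, _); rewrite /fin; lia.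
Qed.

Lemma cstep_growth code n x B : (forall r, rg x.2 r <= B) ->
  forall r, rg (iter n (cstep code) x).2 r <= B + n.
Proof.
move=> h; elim: n => [|n IH] r /=; first by rewrite addn0.
set y := iter n _ x in IH *; rewrite /cstep.
case: (nth _ _ _) => [[m tT] tF] /=.
have le r' : rg y.2 r' <= B + n.+1 by apply: leq_trans (IH r') _; lia.
have lt r' : rg y.2 r' < B + n.+1 by move: (IH r'); lia.
by case: m => [||[a|a|a b|A a b]|t] //=; rewrite /upd; case: ifP.
Qed.

Definition polybound (f : nat -> nat) : Prop :=
  exists K e, forall n, f n <= K * n.+1 ^ e.

Lemma polybound_le f g : (forall n, f n <= g n) -> polybound g -> polybound f.
Proof. by move=> h [K [e H]]; exists K, e => n; apply: leq_trans (h n) (H n). Qed.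

Lemma polybound_const k : polybound (fun=> k).
Proof. by exists k, 0 => n; rewrite expn0 muln1. Qed.

Lemma polybound_id : polybound id.
Proof. by exists 1, 1 => n; rewrite expn1 mul1n. Qed.

Lemma polyboundD f g : polybound f -> polybound g ->
  polybound (fun n => f n + g n).
Proof.
move=> [K [e H]] [K' [e' H']]; exists (K + K'), (e + e') => n.
rewrite mulnDl leq_add //.
  by apply: leq_trans (H n) _; rewrite leq_mul2l leq_pexp2l ?leq_addr ?orbT.
by apply: leq_trans (H' n) _; rewrite leq_mul2l leq_pexp2l ?leq_addl ?orbT.
Qed.

Lemma polyboundM f g : polybound f -> polybound g ->
  polybound (fun n => f n * g n).
Proof.
move=> [K [e H]] [K' [e' H']]; exists (K * K'), (e + e') => n.
by rewrite expnD mulnACA leq_mul.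
Qed.

Lemma polybound_comp f g : polybound f -> polybound g ->
  polybound (fun n => f (g n)).
Proof.
move=> [K [e H]] [K' [e' H']]; exists (K * K'.+1 ^ e), (e' * e) => n.
apply: leq_trans (H _) _; rewrite -mulnA leq_mul2l expnM -expnMn.
case: e {H} => [|e]; first by rewrite !expn0 orbT.
rewrite leq_exp2r //; apply/orP; right.
by move: (H' n) (expn_gt0 n.+1 e'); rewrite /=; lia.
Qed.

Lemma polybound_steps c : polybound (steps c).
Proof.
elim: c => [|o|c1 IH1 c2 IH2|t c1 IH1 c2 IH2|p q c IH] /=.
- exact: polybound_const.
- exact: polybound_const.
- exact: polyboundD.
- by apply: polyboundD; [exact: polyboundD|exact: polybound_const].
- apply: polyboundD (polybound_const _); apply: polyboundM polybound_id _.
  exact: polyboundD IH (polybound_const _).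
Qed.

Definition polytime (c : cmd) : Prop :=
  exists2 f, polybound f & forall B pre post s,
  (forall r, rg s r <= B) -> exists2 n, n <= f B &
    iter n (cstep (pre ++ compile c (size pre) ++ post)) (size pre, s)
      = (size pre + csize c, exec c s).

Lemma polytime_bounded Q c : bounded Q c -> polytime c.
Proof.
move=> hb; exists (steps c); first exact: polybound_steps.
by move=> B pre post s hs; apply: comp_correct hb _ _ _ _ => q _; apply: hs.
Qed.

Lemma polytime_seq c1 c2 : polytime c1 -> polytime c2 -> polytime (Seq c1 c2).
Proof.
move=> [f pf h1] [g pg h2]; exists (fun B => f B + g (B + f B)).
  by apply: polyboundD pf (polybound_comp pg (polyboundD polybound_id pf)).
move=> B pre post s hs.
have [n1 hn1 e1] := h1 B pre (compile c2 (size pre + csize c1) ++ post) s hs.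
have hs2 r : rg (exec c1 s) r <= B + f B.
  have := cstep_growth (pre ++ compile c1 (size pre) ++
    compile c2 (size pre + csize c1) ++ post) n1 (x := (size pre, s)) hs r.
  by rewrite e1 /=; lia.
have [n2 hn2 e2] := h2 _ (pre ++ compile c1 (size pre)) post _ hs2.
exists (n2 + n1); first by rewrite addnC leq_add.
rewrite iterD /= -catA e1; move: e2.
by rewrite size_cat size_comp -!catA => ->; rewrite addnA.
Qed.

(** * Sweeps *)

(* A tape cell carries one bit per register (set exactly at the position equal
   to the value of the register) and one bit per array. *)
Definition cell (K : nat) : finType :=
  ({ffun 'I_K.+1 -> bool} * {ffun 'I_K.+1 -> bool})%type.

Definition cell0 K : cell K := ([ffun=> false], [ffun=> false]).
Definition rbit K (c : cell K) (r : nat) : bool := c.1 (inord r).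
Definition abit K (c : cell K) (A : nat) : bool := c.2 (inord A).
Definition set_rbit K (c : cell K) (r : nat) (b : bool) : cell K :=
  ([ffun i => if nat_of_ord i == r then b else c.1 i], c.2).
Definition set_abit K (c : cell K) (A : nat) (b : bool) : cell K :=
  (c.1, [ffun i => if nat_of_ord i == A then b else c.2 i]).

Lemma rbit_set_rbit K (c : cell K) r b q : q <= K ->
  rbit (set_rbit c r b) q = if q == r then b else rbit c q.
Proof. by move=> hq; rewrite /rbit ffunE inordK. Qed.

Lemma abit_set_abit K (c : cell K) A b A' : A' <= K ->
  abit (set_abit c A b) A' = if A' == A then b else abit c A'.
Proof. by move=> hq; rewrite /abit ffunE inordK. Qed.

Definition init_cell K (b : bool) : cell K :=
  set_abit (set_abit (cell0 K) 1 true) 0 b.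

Definition mstate : finType := option bool.

(* A pass starts in state [None]; ending in [Some true] means that the test
   succeeded. *)
Definition mealy_fun K (m : mop) (z : mstate) (c : cell K) : mstate * cell K :=
  match m with
  | MNop => (z, c)
  | MOp (Zr r) => (Some false, set_rbit c r (z == None))
  | MOp (Inc r) => (Some (rbit c r), set_rbit c r (z == Some true))
  | MOp (Mov r q) => (z, set_rbit c r (rbit c q))
  | MOp (Wr A r b) => (z, if rbit c r then set_abit c A b else c)
  | MTest (Eq r q) => (if rbit c r && rbit c q then Some true else z, c)
  | MTest (Rd A r) => (if abit c A && rbit c r then Some true else z, c)
  | MTest (Lt r q) =>
      (if z is None then
         if rbit c q then Some false else if rbit c r then Some true else None
       else z, c)
  | MInit =>
      (Some (~~ abit c 1),
       ([ffun i : 'I_K.+1 =>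
           if nat_of_ord i == 1 then (z != Some true) && ~~ abit c 1 else z == None],
        c.2))
  end.

Fixpoint mealy K (m : mop) (z : mstate) (w : seq (cell K)) :
    mstate * seq (cell K) :=
  if w is c :: w' then
    let: (z', c') := mealy_fun m z c in
    let: (z'', w'') := mealy m z' w' in (z'', c' :: w'')
  else (z, [::]).

Lemma size_mealy K m z (w : seq (cell K)) : size (mealy m z w).2 = size w.
Proof.
elim: w z => //= c w IH z; case: (mealy_fun m z c) => z' c'.
by have := IH z'; case: (mealy m z' w) => z'' w'' /= ->.
Qed.

Lemma mealy_trace K m (st : nat -> mstate) (w : seq (cell K)) :
  (forall i, i < size w -> (mealy_fun m (st i) (nth (cell0 K) w i)).1 = st i.+1) ->
  (mealy m (st 0) w).1 = st (size w) /\
  (forall i, i < size w -> nth (cell0 K) (mealy m (st 0) w).2 i =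
     (mealy_fun m (st i) (nth (cell0 K) w i)).2).
Proof.
elim: w st => [|c w IH] st h //=.
have := IH (fun i => st i.+1) (fun i => h i.+1).
have := h 0 isT; rewrite /=.
case e: (mealy_fun m (st 0) c) => [z' c'] /= <-.
case: (mealy m z' w) => z'' w'' /= [-> h2]; split=> // -[|i] //=.
  by rewrite e.
exact: h2.
Qed.

Definition represents K (s : store) (w : seq (cell K)) : Prop :=
  [/\ forall r, r <= K -> rg s r < size w,
      forall r i, r <= K -> rbit (nth (cell0 K) w i) r = (rg s r == i) &
      forall A i, A <= K -> abit (nth (cell0 K) w i) A = ar s A i].

Definition fits_op K (o : op) : bool :=
  match o with
  | Zr r | Inc r => r <= K
  | Mov r q => (r <= K) && (q <= K)
  | Wr A r _ => (A <= K) && (r <= K)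
  end.
Definition fits_test K (t : test) : bool :=
  match t with
  | Eq r q | Lt r q | Rd r q => (r <= K) && (q <= K)
  end.
Definition fits K (m : mop) : bool :=
  match m with
  | MInit => false | MNop => true
  | MOp o => fits_op K o
  | MTest t => fits_test K t
  end.

Lemma rbit0 K r : rbit (cell0 K) r = false.
Proof. by rewrite /rbit ffunE. Qed.
Lemma abit0 K r : abit (cell0 K) r = false.
Proof. by rewrite /abit ffunE. Qed.

Lemma represents_rcons K s (w : seq (cell K)) :
  represents s w -> represents s (rcons w (cell0 K)).
Proof.
have e i : nth (cell0 K) (rcons w (cell0 K)) i = nth (cell0 K) w i.
  rewrite nth_rcons; case: ifP => // /negbT; rewrite -leqNgt => h.
  by rewrite (nth_default _ h) if_same.
case=> h1 h2 h3; split=> [r hr|r i hr|A i hA]; rewrite ?e ?h2 ?h3 //.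
by rewrite size_rcons ltnS ltnW ?h1.
Qed.

Lemma mealy_sound K m s (w : seq (cell K)) : fits K m -> represents s w ->
  let: (z, w') := mealy m None (rcons w (cell0 K)) in
  represents (mop_run m s) w' /\ (z == Some true) = mop_flag m s.
Proof.
move=> hm hs0.
have hs : represents s (rcons w (cell0 K)) by exact: represents_rcons.
have hsz r : r <= K -> rg s r < size w by case: hs0 => h _ _; exact: h.
have szW : size (rcons w (cell0 K)) = (size w).+1 by rewrite size_rcons.
move: (rcons w (cell0 K)) szW hs {hs0} => W szW [h1 h2 h3].
suff [st [st0 hst [hrep hfl hlt]]] : exists st : nat -> mstate,
  [/\ st 0 = None,
     forall i, i < size W -> (mealy_fun m (st i) (nth (cell0 K) W i)).1 = st i.+1 &
     [/\ forall i, i < size W ->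
         let c := (mealy_fun m (st i) (nth (cell0 K) W i)).2 in
         (forall r, r <= K -> rbit c r = (rg (mop_run m s) r == i)) /\
         (forall A, A <= K -> abit c A = ar (mop_run m s) A i),
      (st (size W) == Some true) = mop_flag m s &
      forall r, r <= K -> rg (mop_run m s) r < size W]].
  have [] := mealy_trace hst; rewrite st0.
  have := size_mealy m None W.
  case: (mealy m None W) => z w' /= sz -> hn; split; last exact: hfl.
  split=> [r hr|r i hr|A i hA].
  - by rewrite sz; apply: hlt.
  - case: (ltnP i (size W)) => hi; first by rewrite hn //; case: (hrep i hi) => ->.
    rewrite nth_default ?sz // rbit0; apply/esym/negbTE.
    by rewrite ltn_eqF // (leq_trans (hlt r hr)).
  - case: (ltnP i (size W)) => hi; first by rewrite hn //; case: (hrep i hi) => _ ->.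
    rewrite nth_default ?sz // abit0.
    have e0 : ar s A i = false by rewrite -h3 // nth_default // abit0.
    case: m hm {hn sz hst hrep hfl} hlt => [||[r|r|r q|A' r b]|t] //= /andP[hA' hr] _.
    rewrite /upd; case: eqP => [<-|] //; case: eqP => // e.
    by move: (h1 _ hr); rewrite -e ltnNge hi.
case: m hm => [||[r|r|r q|A r b]|[r q|r q|A r]] //=.
- by move=> _; exists (fun=> None); split=> //; split=> // i hi; split=> *; rewrite ?h2 ?h3.
- move=> hr; exists (fun i => if i == 0 then None else Some false); split=> //.
  split=> [i hi||r' hr'].
  + split=> [q hq|A hA]; last by rewrite -h3.
    rewrite rbit_set_rbit // /upd h2 //; case: eqP => // _.
    by case: i {hi}.
  + by case: ifP.
  + by rewrite /upd; case: eqP; rewrite ?szW // => _; rewrite -szW h1.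
- move=> hr; exists (fun i => if i is j.+1 then Some (rg s r == j) else None).
  split=> // [i hi|]; first by rewrite h2.
  split=> [i hi||r' hr'].
  + split=> [q hq|A hA]; last by rewrite -h3.
    rewrite rbit_set_rbit // /upd h2 //; case: eqP => // _.
    by case: i {hi} => // j; case: (rg s r == j) / eqP => [->|/eqP ne];
      rewrite ?eqSS ?eqxx // (negPf ne).
  + by rewrite szW eqE /= ltn_eqF ?hsz.
  + by rewrite /upd; case: eqP; rewrite szW ?ltnS ?hsz // => _; rewrite ltnW ?hsz.
- case/andP=> hr hq; exists (fun=> None); split=> //; split=> // [i hi|r' hr'].
  + split=> [q' hq'|A hA]; last by rewrite -h3.
    by rewrite rbit_set_rbit // /upd !h2 //; case: eqP.
  + by rewrite /upd; case: eqP; rewrite h1.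
- case/andP=> hA hr; exists (fun=> None); split=> //; split=> // i hi.
  split=> [q' hq'|A' hA'].
    by case: ifP => _; rewrite -h2.
  rewrite h2 // /upd (fun_if (fun f : nat -> bool => f i)) [i == _]eq_sym.
  case: (rg s r == i); first by rewrite abit_set_abit // h3.
  by rewrite h3 //; case: eqP => // ->.
- case/andP=> hr hq.
  exists (fun i => if (rg s r == rg s q) && (rg s r < i) then Some true else None).
  split=> // [|i hi|]; first by rewrite ltn0 andbF.
    rewrite !h2 //; case: (rg s r =P rg s q) => [<-|ne] /=.
      by rewrite andbb ltnS; case: ltngtP.
    by case: eqP => //= <-; rewrite eq_sym; case: eqP ne.
  split=> [i hi||r' hr']; last by rewrite h1.
    by split=> *; rewrite -?h2 -?h3.
  by rewrite h1 // andbT; case: (rg s r == rg s q).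
- case/andP=> hr hq.
  exists (fun i => if minn (rg s r) (rg s q) < i then Some (rg s r < rg s q) else None).
  split=> // [i hi|]; last first.
    split=> [i hi||r' hr']; last by rewrite h1.
      by split=> *; rewrite -?h2 -?h3.
    by rewrite gtn_min h1 //; case: (rg s r < rg s q).
  rewrite !h2 // /minn ltnS.
  case: (ltngtP (rg s r) (rg s q)) => h'.
  + case: (ltngtP (rg s r) i) => // [h|<-]; first by rewrite gtn_eqF ?(ltn_trans h).
    by rewrite gtn_eqF.
  + by case: (ltngtP (rg s q) i) => // h; rewrite gtn_eqF ?(ltn_trans h).
  + by rewrite h'; case: (ltngtP (rg s q) i).
- case/andP=> hA hr.
  exists (fun i => if ar s A (rg s r) && (rg s r < i) then Some true else None).
  split=> // [|i hi|]; first by rewrite ltn0 andbF.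
    rewrite h2 // h3 // ltnS; case: ltngtP => [||<-]; rewrite ?andbF ?andbT //.
  split=> [i hi||r' hr']; last by rewrite h1.
    by split=> *; rewrite -?h2 -?h3.
  by rewrite h1 // andbT; case: (ar s A _).
Qed.

Lemma mealy_init K (x : seq bool) : 0 < K ->
  represents (init_store x)
    (mealy MInit None (rcons (map (init_cell K) x) (cell0 K))).2.
Proof.
move=> hK; set W := rcons _ _.
have szW : size W = (size x).+1 by rewrite size_rcons size_map.
have hA A i : A <= K -> abit (nth (cell0 K) W i) A = ar (init_store x) A i.
  move=> hA; rewrite nth_rcons size_map /=.
  case: ltnP => h.
    rewrite (nth_map false) // /init_cell !abit_set_abit // abit0.
    by case: (A == 0) => //; case: (A == 1).
  rewrite if_same abit0 andbF; case: (A == 0) => //.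
  by rewrite nth_default.
pose st i : mstate := if i is j.+1 then Some (~~ (j < size x)) else None.
have hst i : i < size W ->
    (mealy_fun MInit (st i) (nth (cell0 K) W i)).1 = st i.+1.
  by move=> hi /=; rewrite hA.
have [_ hn] := mealy_trace hst.
have sz := size_mealy MInit None W.
split=> [r hr|r i hr|A i hA'].
- by rewrite sz szW /=; case: ifP.
- case: (ltnP i (size W)) => hi; last first.
    rewrite nth_default ?sz // rbit0; apply/esym/ltn_eqF/(leq_trans _ hi).
    by rewrite szW /=; case: (r == 1).
  rewrite hn // /rbit /= ffunE inordK // hA //=; case: (r == 1) => /=.
    case: i hi => [|j] hj /=; first by rewrite lt0n negbK.
    move: hj; rewrite szW -[Some _ == _]/(~~ (j < size x) == true) eqb_id negbK.
    by rewrite ltnS; case: ltngtP => //= ; lia.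
  by case: i {hi}.
- case: (ltnP i (size W)) => hi; first by rewrite hn //; exact: hA.
  rewrite nth_default ?sz // abit0 -hA //; rewrite nth_default // abit0 //.
Qed.

(** * The Turing machine *)

Definition sym_of_cell K (c : cell K) : 'I_(#|cell K|).+3 := inord (3 + enum_rank c).

Definition cell_of_sym K (a : 'I_(#|cell K|).+3) : option (cell K) :=
  match val a with
  | 0 => None
  | 1 => Some (init_cell K false)
  | 2 => Some (init_cell K true)
  | n.+3 => Some (nth (cell0 K) (enum (cell K)) n)
  end.

Lemma sym_of_cellK K (c : cell K) : cell_of_sym (sym_of_cell c) = Some c.
Proof.
rewrite /cell_of_sym /sym_of_cell /= inordK ?ltnS ?add3n; last exact: (ltn_ord (enum_rank c)).
by rewrite nth_enum_rank.
Qed.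

Definition cstate (L : nat) : finType := ('I_L.+2 * (mstate + bool))%type.
Definition cstate0 L : cstate L := (ord0, inl None).

Definition state_num L := #|cstate L|.-1.
Definition enc_state L (q : cstate L) : 'I_(state_num L).+1 := inord (enum_rank q).
Definition dec_state L (i : 'I_(state_num L).+1) : cstate L :=
  nth (cstate0 L) (enum (cstate L)) i.

Lemma enc_stateK L : cancel (@enc_state L) (@dec_state L).
Proof.
move=> q; rewrite /dec_state /enc_state inordK ?nth_enum_rank //.
rewrite /state_num prednK ?ltn_ord //.
by apply/card_gt0P; exists q.
Qed.

(* In state [(pc, inl z)] the head runs right through the pass of instruction
   [pc]; at the first blank it appends a cell and turns, and in state
   [(pc, inr b)] it runs back to the left end, carrying the outcome [b]. *)
Definition code_delta K (code : seq instr) (q : cstate (size code))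
    (a : 'I_(#|cell K|).+3) : cstate (size code) * 'I_(#|cell K|).+3 * move :=
  let: (m, tT, tF) := nth ninstr code q.1 in
  match q.2, cell_of_sym a with
  | inl z, Some c =>
      let: (z', c') := mealy_fun m z c in ((q.1, inl z'), sym_of_cell c', MoveR)
  | inl z, None =>
      let: (z', c') := mealy_fun m z (cell0 K) in
      ((q.1, inr (z' == Some true)), sym_of_cell c', MoveL)
  | inr b, Some _ => (q, a, MoveL)
  | inr b, None => ((inord (if b then tT else tF), inl None), a, MoveR)
  end.

Definition pc_state (code : seq instr) (pc : nat) : cstate (size code) :=
  (inord pc, inl None).

Definition code_TM K (code : seq instr) : TM :=
  {| nQ := state_num (size code); nG := #|cell K|;
     delta := fun q a =>
       let: (q', a', mv) := code_delta (dec_state q) a in (enc_state q', a', mv);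
     q_start := enc_state (pc_state code 0);
     q_acc := enc_state (pc_state code (size code).+1);
     q_rej := enc_state (pc_state code (size code)) |}.

Definition cfg_right K code (q : cstate (size code)) l r : config (code_TM K code) :=
  match r with
  | [::] => @Config (code_TM K code) (enc_state q) l ord0 [::]
  | a :: r' => @Config (code_TM K code) (enc_state q) l a r'
  end.

Definition cfg_left K code (q : cstate (size code)) l r : config (code_TM K code) :=
  match l with
  | [::] => @Config (code_TM K code) (enc_state q) [::] ord0 r
  | a :: l' => @Config (code_TM K code) (enc_state q) l' a r
  end.

Lemma code_TM_running K code (q : cstate (size code)) l a r : q.1 < size code ->
  halted (@Config (code_TM K code) (enc_state q) l a r) = false.
Proof.
move=> hq; rewrite /halted /=; apply/norP.
by split; apply: contraTneq hq => /(can_inj (@enc_stateK _)) ->;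
  rewrite /= inordK // -leqNgt ?leqnSn.
Qed.

Lemma tm_step_right K code (q : cstate (size code)) z a c l r :
  q.1 < size code -> q.2 = inl z -> cell_of_sym a = Some c ->
  let: (z', c') := mealy_fun (nth ninstr code q.1).1.1 z c in
  tm_step (cfg_right (K := K) q l (a :: r)) =
  cfg_right (q.1, inl z') (sym_of_cell c' :: l) r.
Proof.
move=> hq hz ha; rewrite /tm_step code_TM_running //= enc_stateK /code_delta hz ha.
case: (nth _ _ _) => [[m tT] tF] /=.
by case: (mealy_fun m z c) => z' c' /=; case: r.
Qed.

Lemma tm_step_turn K code (q : cstate (size code)) z l :
  q.1 < size code -> q.2 = inl z ->
  let: (z', c') := mealy_fun (nth ninstr code q.1).1.1 z (cell0 K) in
  tm_step (cfg_right (K := K) q l [::]) =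
  cfg_left (q.1, inr (z' == Some true)) l [:: sym_of_cell c'].
Proof.
move=> hq hz; rewrite /tm_step code_TM_running //= enc_stateK /code_delta hz.
have -> : cell_of_sym (K := K) ord0 = None by [].
case: (nth _ _ _) => [[m tT] tF] /=.
by case: (mealy_fun m z _) => z' c' /=; case: l.
Qed.

Lemma tm_step_left K code (q : cstate (size code)) b a l r :
  q.1 < size code -> q.2 = inr b -> cell_of_sym (K := K) a != None ->
  tm_step (cfg_left q (a :: l) r) = cfg_left q l (a :: r).
Proof.
move=> hq hz ha; rewrite /tm_step code_TM_running //= enc_stateK /code_delta hz.
case: (nth _ _ _) => [[m tT] tF] /=.
by case: (cell_of_sym a) ha => // c _ /=; case: l.
Qed.

Lemma tm_step_restart K code (q : cstate (size code)) b l a r :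
  q.1 < size code -> q.2 = inr b -> l = [::] \/ l = [:: ord0] ->
  let: (m, tT, tF) := nth ninstr code q.1 in
  tm_step (cfg_left (K := K) q l (a :: r)) =
  cfg_right (pc_state code (if b then tT else tF)) [:: ord0] (a :: r).
Proof.
move=> hq hz hl.
have -> : cfg_left (K := K) q l (a :: r) = cfg_left q [::] (a :: r).
  by case: hl => ->.
rewrite /tm_step code_TM_running //= enc_stateK /code_delta hz.
have -> : cell_of_sym (K := K) ord0 = None by [].
by case: (nth _ _ _) => [[m tT] tF] /=.
Qed.

Lemma right_sweep K code (q : cstate (size code)) z l syms (w : seq (cell K)) :
  q.1 < size code -> map (@cell_of_sym K) syms = map Some w ->
  iter (size w) (@tm_step _) (cfg_right (q.1, inl z) l syms) =
  let: (z', w') := mealy (nth ninstr code q.1).1.1 z w in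
  cfg_right (q.1, inl z') (catrev (map (@sym_of_cell K) w') l) [::].
Proof.
move=> hq; elim: w z l syms => [|c w IH] z l [|a syms] // [ha hw].
rewrite [size _]/= iterSr.
have := @tm_step_right K code (q.1, inl z) z a c l syms hq erefl ha.
rewrite [_.1]/= /=; case: (mealy_fun _ z c) => z' c' ->.
rewrite IH //; by case: (mealy _ z' w).
Qed.

Lemma left_sweep K code (q : cstate (size code)) b l0 l r :
  q.1 < size code -> q.2 = inr b -> all (fun a => cell_of_sym (K := K) a != None) l ->
  iter (size l) (@tm_step _) (cfg_left q (l ++ l0) r) =
  cfg_left q l0 (catrev l r).
Proof.
move=> hq hb; elim: l r => [|a l IH] r //= /andP[ha hl].
by rewrite -iterS iterSr (tm_step_left _ _ hq hb) // IH.
Qed.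

Lemma mealy_rcons K m z (w : seq (cell K)) c :
  mealy m z (rcons w c) =
  let: (z1, w1) := mealy m z w in
  let: (z2, c2) := mealy_fun m z1 c in (z2, rcons w1 c2).
Proof.
elim: w z => [|a w IH] z /=; first by case: (mealy_fun m z c).
case: (mealy_fun m z a) => z' a'; rewrite IH.
by case: (mealy m z' w) => z1 w1; case: (mealy_fun m z1 c).
Qed.

Lemma full_sweep K code pc l syms (w : seq (cell K)) :
  pc < size code -> l = [::] \/ l = [:: ord0] ->
  map (@cell_of_sym K) syms = map Some w ->
  let: (m, tT, tF) := nth ninstr code pc in
  let: (z, w') := mealy m None (rcons w (cell0 K)) in
  iter ((size w).*2 + 2) (@tm_step _) (cfg_right (pc_state code pc) l syms) =
  cfg_right (pc_state code (if z == Some true then tT else tF)) [:: ord0]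
    (map (@sym_of_cell K) w').
Proof.
move=> hpc hl hs.
have hpcE : nat_of_ord (@inord (size code).+1 pc) = pc by rewrite inordK //; lia.
set q := pc_state code pc.
have hq : q.1 < size code by rewrite hpcE.
case e: (nth _ _ _) => [[m tT] tF]; rewrite mealy_rcons.
have -> : (size w).*2 + 2 = 1 + (size w + (1 + size w)) by lia.
rewrite iterD (iterD (size w)) (iterD 1).
have := right_sweep None l hq hs; rewrite -/q.
have -> : (q.1, inl None) = q by [].
move=> ->; rewrite hpcE e [_.1.1]/=.
have sz := size_mealy m None w.
case: (mealy m None w) sz => z1 w1 /= sz.
have := @tm_step_turn K code (q.1, inl z1) z1 (catrev (map (@sym_of_cell K) w1) l) hq erefl.
rewrite [_.1]/= hpcE e [_.1.1]/=.
case: (mealy_fun m z1 _) => z2 c2 ->.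
rewrite catrevE -sz -(size_map (@sym_of_cell K)) -size_rev.
rewrite (@left_sweep K code (q.1, inr (z2 == Some true)) (z2 == Some true)) //; last first.
  by apply/allP=> a; rewrite mem_rev => /mapP[c _ ->]; rewrite sym_of_cellK.
rewrite catrevE revK.
have [a [r er]] : exists a r, map (@sym_of_cell K) w1 ++ [:: sym_of_cell c2] = a :: r.
  by case: (w1) => [|b w2] /=; eexists; eexists.
have := @tm_step_restart K code (q.1, inr (z2 == Some true)) (z2 == Some true) l a r hq erefl hl.
rewrite -er [_.1]/= hpcE e => ->.
by rewrite map_rcons cats1.
Qed.

Definition code_ok K (code : seq instr) : bool :=
  all (fun i : instr => fits K i.1.1) (behead code).

Lemma code_TM_simulates K code : code_ok K code -> forall n pc s (w : seq (cell K)),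
  0 < pc -> represents s w ->
  (forall k, k < n -> 0 < (iter k (cstep code) (pc, s)).1 < size code) ->
  exists t w', [/\ t <= n * ((size w + n).*2 + 2),
    represents (iter n (cstep code) (pc, s)).2 w' &
    iter t (@tm_step _) (cfg_right (pc_state code pc) [:: ord0] (map (@sym_of_cell K) w))
    = cfg_right (pc_state code (iter n (cstep code) (pc, s)).1) [:: ord0]
        (map (@sym_of_cell K) w')].
Proof.
move=> hok n; elim: n => [|n IH] pc s w hpc hs hrun; first by exists 0, w.
have /andP[_ hpc1] := hrun 0 isT.
have hfit : fits K (nth ninstr code pc).1.1.
  case: (pc) hpc hpc1 => // pc' _ hp; rewrite -nth_behead.
  by move/all_nthP: hok; apply; rewrite size_behead -ltnS prednK //; apply: leq_trans hp.
have := @full_sweep K code pc [:: ord0] (map (@sym_of_cell K) w) w hpc1 (or_intror erefl).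
rewrite -map_comp (eq_map (@sym_of_cellK K)) => /(_ erefl).
have := mealy_sound hfit hs.
have := size_mealy (nth ninstr code pc).1.1 None (rcons w (cell0 K)).
rewrite size_rcons.
rewrite iterSr; set y := cstep code (pc, s).
have ey : y = let: (m, tT, tF) := nth ninstr code pc in
    (if mop_flag m s then tT else tF, mop_run m s) by [].
move: ey; case: (nth _ _ _) hfit => [[m tT] tF] /= hfit ey.
case: (mealy m None _) => z w1 /= sz [hw1 hz] e1.
case: n IH hrun => [|n] IH hrun.
  exists ((size w).*2 + 2), w1; split; first by rewrite mul1n leq_add2r leq_double leq_addr.
    by rewrite [iter 0 _ _]/= ey.
  by rewrite e1 [iter 0 _ _]/= ey /= -hz.
have hy : 0 < y.1 by have /andP[] := hrun 1 isT.
have hyw : represents y.2 w1 by rewrite ey.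
have [|t [w' [ht hw' e2]]] := IH y.1 y.2 w1 hy hyw.
  by move=> k hk; rewrite -surjective_pairing -iterSr; apply: hrun.
exists (t + ((size w).*2 + 2)), w'; split.
- rewrite sz in ht; apply: leq_trans (_ : n.+1 * (((size w).+1 + n.+1).*2 + 2) + ((size w).*2 + 2) <= _).
    by rewrite leq_add2r.
  rewrite addSnnS [n.+2 * _]mulSn [X in X <= _]addnC leq_add //.
  by rewrite leq_add2r leq_double leq_addr.
- by rewrite -surjective_pairing in hw'.
- rewrite iterD e1 hz.
  have <- : y.1 = (if mop_flag m s then tT else tF) by rewrite ey.
  by rewrite -surjective_pairing in e2.
Qed.

Definition in_range (a b : nat) (i : instr) : bool :=
  (a <= i.1.2 <= b) && (a <= i.2 <= b).

Lemma in_range_sub a b a' b' l : a' <= a -> b <= b' ->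
  all (in_range a b) l -> all (in_range a' b') l.
Proof.
move=> ha hb; apply: sub_all => i /andP[/andP[h1 h2] /andP[h3 h4]].
by rewrite /in_range !(leq_trans ha) // !(leq_trans _ hb).
Qed.

Lemma comp_range c pc : all (in_range pc (pc + csize c)) (compile c pc).
Proof.
elim: c pc => [|o|c1 IH1 c2 IH2|t c1 IH1 c2 IH2|p q c IH] pc /=.
- by rewrite /in_range /=; lia.
- by rewrite /in_range /=; lia.
- rewrite all_cat (in_range_sub _ _ (IH1 _)) ?(in_range_sub _ _ (IH2 _)) //; lia.
- rewrite all_cat /= (in_range_sub _ _ (IH1 _)) ?(in_range_sub _ _ (IH2 _)) //; rewrite /in_range /=; lia.
- rewrite all_rcons (in_range_sub _ _ (IH _)) //; rewrite /in_range /=; lia.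
Qed.

Definition cmd_code (c : cmd) (t : test) : seq instr :=
  (MInit, 1, 1) :: compile c 1 ++ [:: (MTest t, (csize c).+3, (csize c).+2)].

Lemma size_cmd_code c t : size (cmd_code c t) = (csize c).+2.
Proof. by rewrite /= size_cat size_comp addn1. Qed.

(* The last instruction is replaced by a self-loop, so that the exit address is
   reached at a first time, after which the store no longer changes. *)
Lemma cmd_code_run c t s n :
  iter n (cstep ((MInit, 1, 1) :: compile c 1 ++ [:: (MNop, (csize c).+1, (csize c).+1)]))
    (1, s) = ((csize c).+1, exec c s) ->
  exists m, [/\ m <= n,
    forall k, k <= m -> 0 < (iter k (cstep (cmd_code c t)) (1, s)).1 < (csize c).+2 &
    iter m (cstep (cmd_code c t)) (1, s) = ((csize c).+1, exec c s)].
Proof.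
set e := (csize c).+1.
pose loop := (MInit, 1, 1) :: compile c 1 ++ [:: (MNop, e, e)].
rewrite -/loop => hn.
have hnth pc : 0 < pc < e -> exists2 i, nth ninstr loop pc = i &
    nth ninstr (cmd_code c t) pc = i /\ in_range 1 e i.
  case: pc => // pc /=; rewrite ltnS => hpc.
  rewrite !nth_cat size_comp hpc; eexists; first by []; split=> //.
  have /all_nthP h := comp_range c 1.
  by have := h ninstr pc; rewrite size_comp add1n; apply.
have hend : nth ninstr loop e = (MNop, e, e).
  by rewrite /= nth_cat size_comp ltnn subnn.
have hpc k : 0 < (iter k (cstep loop) (1, s)).1 <= e.
  elim: k => [|k] //=; move: (iter k _ _) => [pc s'] /= /andP[h1 h2].
  rewrite /cstep [_.1]/=.
  case: (ltngtP pc e) h2 => // [h2 _|-> _]; last first.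
    by rewrite hend /= ltnSn.
  have [i -> [_]] := hnth pc (introT andP (conj h1 h2)).
  case: i => [[m tT] tF] /andP[/= /andP[a1 a2] /andP[a3 a4]].
  by case: ifP => _; rewrite ?a1 ?a3.
have hex : exists m, (iter m (cstep loop) (1, s)).1 == e.
  by exists n; rewrite hn.
case: (ex_minnP hex) => m /eqP hm hmin.
have hmn : m <= n by apply: hmin; rewrite hn.
have hstay k : iter (k + m) (cstep loop) (1, s) = iter m (cstep loop) (1, s).
  elim: k => //= k ->; move: hm; case: (iter m _ _) => pc s' /= ->.
  by rewrite /cstep hend.
have hme : iter m (cstep loop) (1, s) = (e, exec c s).
  by rewrite -hn -(subnK hmn) hstay.
have hsame k : k <= m ->
    iter k (cstep (cmd_code c t)) (1, s) = iter k (cstep loop) (1, s).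
  elim: k => //= k IH hk; rewrite IH; last exact: ltnW.
  have : (iter k (cstep loop) (1, s)).1 != e.
    by apply: contraL hk => /hmin; rewrite leqNgt.
  have := hpc k; move: (iter k _ _) => [pc s'] /= /andP[h1 h2] ne.
  rewrite /cstep [_.1]/=.
  have [|i -> [-> _]] // := hnth pc.
  by rewrite h1 ltn_neqAle ne.
exists m; split=> //; last by rewrite hsame.
by move=> k hk; rewrite hsame // ltnS hpc.
Qed.

Theorem poly_time_decidable_cmd K c t (L : seq bool -> Prop) :
  0 < K -> code_ok K (cmd_code c t) -> polytime c ->
  (forall x, run_test t (exec c (init_store x)) <-> L x) ->
  poly_time_decidable L.
Proof.
move=> hK hok [f [cf [ef hf]] hc] hL.
set code := cmd_code c t.
have hsz : size code = (csize c).+2 by exact: size_cmd_code.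
pose time n := n.*2 + 2 + (f n + 1) * ((n + 1 + (f n + 1)).*2 + 2).
have [C [e htime]] : polybound time.
  have pf : polybound (fun n => f n + 1).
    by apply: polyboundD (polybound_const 1); exists cf, ef.
  have p2 g : polybound g -> polybound (fun n => (g n).*2 + 2).
    move=> pg; apply: polyboundD (polybound_const 2).
    apply: polybound_le (polyboundD pg pg) => n; by rewrite addnn.
  apply: polyboundD; first exact: p2 polybound_id.
  apply: (polyboundM pf); apply: p2; apply: (polyboundD _ pf).
  exact: polyboundD polybound_id (polybound_const 1).
exists (code_TM K code), (C * 2 ^ e), e; split.
  rewrite /=; apply/eqP => /(can_inj (@enc_stateK _)) [].
  move/(congr1 val); rewrite /= !inordK //; lia.
move=> x.
have hinit : tm_init (code_TM K code) x =
    cfg_right (pc_state code 0) [::] (map (bit_sym (code_TM K code)) x).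
  by case: x.
have hsyms : map (@cell_of_sym K) (map (bit_sym (code_TM K code)) x) =
    map Some (map (init_cell K) x).
  by rewrite -!map_comp; apply: eq_map => -[]; rewrite /cell_of_sym /= /bit_sym /= inordK.
have := @full_sweep K code 0 [::] _ _ isT (or_introl erefl) hsyms.
have := mealy_init x hK.
have := size_mealy MInit None (rcons (map (init_cell K) x) (cell0 K)).
rewrite /= size_rcons !size_map.
case: (mealy MInit None _) => z w0 /= szw hw0; rewrite if_same => hsweep.
have hB r : rg (init_store x) r <= size x by rewrite /=; case: ifP.
have [n hn hrun] := hc _ [:: (MInit, 1, 1)]
  [:: (MNop, (csize c).+1, (csize c).+1)] _ hB.
have [m [hmn hrange hm]] := cmd_code_run t hrun.
have := @code_TM_simulates K code hok m.+1 1 (init_store x) w0 isT hw0.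
case.
  by move=> k hk; rewrite hsz; apply: hrange.
move=> t1 [w1 [ht1 hw1 hsim]].
have hfin : iter m.+1 (cstep code) (1, init_store x) =
    (if run_test t (exec c (init_store x)) then (csize c).+3 else (csize c).+2,
     exec c (init_store x)).
  rewrite iterS hm /cstep [_.1]/= /code /cmd_code /= nth_cat size_comp ltnn subnn //.
rewrite hfin /= in hsim hw1.
exists (t1 + ((size x).*2 + 2)).
have hend : tm_run (code_TM K code) (t1 + ((size x).*2 + 2)) x = cfg_right
     (pc_state code (if run_test t (exec c (init_store x)) then (csize c).+3 else (csize c).+2))
     [:: ord0] (map (@sym_of_cell K) w1).
  by rewrite /tm_run hinit iterD hsweep hsim.
have hst : c_state (tm_run (code_TM K code) (t1 + ((size x).*2 + 2)) x) =
  if run_test t (exec c (init_store x)) then q_acc (code_TM K code) else q_rej (code_TM K code).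
  have stE pc l r : c_state (cfg_right (K := K) (pc_state code pc) l r) = enc_state (pc_state code pc).
    by case: r.
  rewrite hend stE; case: run_test; congr (enc_state (pc_state code _)); by rewrite hsz.
rewrite /halted hst; split; last split.
- apply: leq_trans (_ : C * (size x).+1 ^ e <= _).
    apply: leq_trans (htime _); rewrite /time addnC leq_add2l.
    apply: leq_trans ht1 _; rewrite szw leq_mul //; first by lia.
    by rewrite leq_add2r leq_double; lia.
  case: (size x) => [|k]; first by rewrite exp1n muln1 -[X in X <= _]muln1 (leq_trans _ (leq_addl _ _)) // leq_mul2l expn_gt0 orbT.
  apply: leq_trans (leq_addr _ _); rewrite -mulnA leq_mul2l -expnMn.
  case: e {htime} => [|e]; first by rewrite !expn0 orbT.
  by rewrite leq_exp2r //; apply/orP; right; lia.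
- by case: ifP => _; rewrite eqxx ?orbT.
- rewrite -hL; case: run_test; split=> // /(can_inj (@enc_stateK _)) [].
  move/(congr1 val); rewrite /= !inordK //; lia.
Qed.

(** * The auction *)

Record auction_inv (a b : nat) (w : nat -> nat -> nat) (M : nat)
    (p : nat -> nat) (X : nat -> nat -> bool) : Prop := AuctionInv {
  auction_fun : forall i j j', i < a -> j < b -> j' < b -> X i j -> X i j' -> j = j';
  auction_inj : forall i i' j, i < a -> i' < a -> j < b -> X i j -> X i' j -> i = i';
  auction_slack : forall i j k, i < a -> j < b -> k < b -> X i j ->
    w i j + p j <= w i k + p k + 1;
  auction_owned : forall j, j < b -> 0 < p j -> exists2 i, i < a & X i j;
  auction_price : forall j, j < b -> p j <= M.+1
}.

Definition assign (X : nat -> nat -> bool) (i j : nat) : nat -> nat -> bool :=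
  fun i' j' => if j' == j then i' == i else X i' j'.

Lemma auction_free a b w M p X i : a <= b -> auction_inv a b w M p X ->
  i < a -> (forall j, j < b -> ~~ X i j) -> exists2 k, k < b & p k = 0.
Proof.
move=> hab inv hi hX.
case: (boolP [exists k : 'I_b, p k == 0]) => [/existsP[k /eqP hk]|].
  by exists k.
rewrite negb_exists => /forallP hp.
have own (k : 'I_b) : exists r : 'I_a, X r k.
  have [|r hr hX'] := auction_owned inv (ltn_ord k).
  - by rewrite lt0n hp.
  - by exists (Ordinal hr).
have [f hf] := fin_all_exists own.
have finj : injective f.
  move=> k k' e; apply: val_inj; apply: (auction_fun inv (ltn_ord (f k)) (ltn_ord k) (ltn_ord k') (hf k)).
  by rewrite e.
have : #|f @: setT| <= #|[set~ Ordinal hi]|.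
  apply/subset_leq_card/subsetP => r /imsetP[k _ ->]; rewrite !inE.
  by apply: contraNneq (hX k (ltn_ord k)) => e; have := hf k; rewrite e.
by rewrite card_imset // cardsT cardsC1 !card_ord; lia.
Qed.

Lemma auction_bid a b w M p X i j : a <= b -> auction_inv a b w M p X ->
  (forall i j, i < a -> j < b -> w i j <= M) ->
  i < a -> (forall j, j < b -> ~~ X i j) -> j < b ->
  (forall k, k < b -> w i j + p j <= w i k + p k) ->
  auction_inv a b w M (upd p j (p j).+1) (assign X i j).
Proof.
move=> hab inv hw hi hX hj hmin.
have [k0 hk0 pk0] := auction_free hab inv hi hX.
have pj : p j <= M by have := hmin _ hk0; have := hw _ _ hi hk0; lia.
have le k : p k <= upd p j (p j).+1 k.
  by rewrite /upd; case: eqP => [->|]; lia.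
split.
- rewrite /assign => i' j1 j2 hi' h1 h2.
  case: (j1 =P j) => [->|_]; case: (j2 =P j) => [->|_] //.
  + by move=> /eqP -> h; have := hX _ h2; rewrite h.
  + by move=> h /eqP e; have := hX _ h1; rewrite -e h.
  + exact: (auction_fun inv).
- rewrite /assign => i1 i2 j' h1 h2 hj'.
  case: (j' =P j) => _; last exact: (auction_inj inv).
  by move=> /eqP -> /eqP ->.
- move=> i' j' k hi' hj' hk; rewrite /assign; case: (j' =P j) => [->|ne].
    move=> /eqP ->; have := hmin _ hk; have := le k.
    by rewrite {2}/upd eqxx; lia.
  move=> h; have := auction_slack inv hi' hj' hk h; have := le k.
  by rewrite {2}/upd; case: eqP => //; lia.
- move=> j' hj'; rewrite /upd /assign; case: eqP => _ h; first by exists i.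
  exact: (auction_owned inv).
- move=> j' hj'; rewrite /upd; case: eqP => _; first by [].
  exact: (auction_price inv).
Qed.

Lemma sum_upd b (p : nat -> nat) j : j < b ->
  \sum_(k < b) upd p j (p j).+1 k = (\sum_(k < b) p k).+1.
Proof.
move=> hj; rewrite (bigD1 (Ordinal hj)) //= [in RHS](bigD1 (Ordinal hj)) //=.
rewrite /upd eqxx addSn; congr (_ + _).+1; apply: eq_bigr => k.
by rewrite -val_eqE /= => /negPf ->.
Qed.

Lemma auction_sum a b w M p X : auction_inv a b w M p X ->
  \sum_(k < b) p k <= b * M.+1.
Proof.
move=> inv; rewrite -[X in X * _]card_ord -sum_nat_const.
by apply: leq_sum => k _; apply: (auction_price inv).
Qed.

Definition injection (a b : nat) (f : nat -> nat) : Prop :=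
  (forall i, i < a -> f i < b) /\
  (forall i i', i < a -> i' < a -> f i = f i' -> i = i').

Lemma injection_sum a b f (p : nat -> nat) : injection a b f ->
  \sum_(i < a) p (f i) <= \sum_(j < b) p j /\
  ((forall j, j < b -> 0 < p j -> exists2 i, i < a & f i = j) ->
   \sum_(i < a) p (f i) = \sum_(j < b) p j).
Proof.
move=> [hr hinj].
pose F (i : 'I_a) : 'I_b := Ordinal (hr i (ltn_ord i)).
have Finj : injective F.
  move=> i i' /(congr1 val) e; apply: val_inj.
  exact: (hinj _ _ (ltn_ord i) (ltn_ord i') e).
have e : \sum_(i < a) p (f i) = \sum_(j in F @: setT) p j.
  by rewrite big_imset /=; [apply: eq_bigl => i; rewrite inE | move=> *; apply: Finj].
split=> [|h]; first by rewrite e [X in _ <= X](bigID (mem (F @: setT))) leq_addr.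
rewrite e [RHS](bigID (mem (F @: setT))) /= [X in _ + X]big1 ?addn0 // => j hj.
apply/eqP; rewrite -leqn0 leqNgt; apply/negP => /(h _ (ltn_ord j)) [i hi fi].
move/negP: hj; apply; apply/imsetP; exists (Ordinal hi) => //.
exact: val_inj.
Qed.

Lemma auction_optimal a b w p f g : injection a b f -> injection a b g ->
  (forall i k, i < a -> k < b -> w i (f i) + p (f i) <= w i k + p k + 1) ->
  (forall j, j < b -> 0 < p j -> exists2 i, i < a & f i = j) ->
  \sum_(i < a) w i (f i) <= \sum_(i < a) w i (g i) + a.
Proof.
move=> hf hg hcs hown.
have e := (injection_sum p hf).2 hown.
have le := (injection_sum p hg).1.
have : \sum_(i < a) (w i (f i) + p (f i)) <= \sum_(i < a) (w i (g i) + p (g i) + 1).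
  by apply: leq_sum => i _; apply: hcs => //; case: hg => h _; apply: h.
rewrite !big_split /= sum1_card card_ord e; move: le {e}; do 4!move: (\sum_(_ < _) _) => ?; lia.
Qed.

Definition is_half (c : compat) := if c is HalfComp then true else false.
Definition is_incomp (c : compat) := if c is Incomp then true else false.

(* Forbidden pairs cost more than any matching without them; the factor [a.+1]
   absorbs the additive error [a] of the auction. *)
Definition weight (a : nat) (c : compat) : nat :=
  a.+1 * (is_half c + a.+1 * is_incomp c).

Lemma weight_le a c : weight a c <= a.+1 * a.+1.
Proof. by rewrite /weight leq_mul2l; case: c => /=; lia. Qed.

Definition good_injection (a b : nat) (c : nat -> nat -> compat) (h : nat) (f : nat -> nat) :=
  [/\ injection a b f, forall i, i < a -> ~~ is_incomp (c i (f i)) &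
      \sum_(i < a) is_half (c i (f i)) <= h].

Lemma auction_decides a b c p f h : injection a b f ->
  (forall i k, i < a -> k < b ->
     weight a (c i (f i)) + p (f i) <= weight a (c i k) + p k + 1) ->
  (forall j, j < b -> 0 < p j -> exists2 i, i < a & f i = j) ->
  (exists g, good_injection a b c h g) <-> good_injection a b c h f.
Proof.
move=> hf hcs hown; split=> [[g [hg1 hg2 hg3]]|]; last by exists f.
have := auction_optimal (w := fun i j => weight a (c i j)) hf hg1 hcs hown.
rewrite /weight -!big_distrr /= !big_split -!big_distrr /=.
set Hf := \sum_(i < a) is_half (c i (f i)).
set Hg := \sum_(i < a) is_half (c i (g i)) in hg3 *.
have -> : \sum_(i < a) is_incomp (c i (g i)) = 0.
  by rewrite big1 // => i _; rewrite (negPf (hg2 i _)).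
set If := \sum_(i < a) is_incomp (c i (f i)).
rewrite muln0 addn0 => le.
have le1 : Hf + a.+1 * If <= Hg.
  rewrite -ltnS -(ltn_pmul2l (ltn0Sn a)); apply: leq_ltn_trans le _.
  by rewrite mulnS; lia.
have leg : Hg <= a.
  rewrite -[X in _ <= X](card_ord a) -sum1_card; apply: leq_sum => i _.
  by case: is_half.
have If0 : If = 0 by case: (If) le1 => // n; rewrite mulnS; lia.
split=> //; last by lia.
move=> i hi; move/eqP: If0; rewrite sum_nat_eq0 => /forallP /(_ (Ordinal hi)) /=.
by case: is_incomp.
Qed.

(** * Allocations and injections *)

Lemma allKEI_yesP (I : instance) (h : int) : allKEI_yes I h <->
  exists f : recipient (np I) (na I) -> donor (np I) (nb I),
    [/\ injective f, forall r, ~~ is_incomp (st r (f r)) &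
        ((\sum_r is_half (st r (f r)))%N%:Z <= h)%R].
Proof.
have cardE (P : pred (recipient (np I) (na I))) : #|[set r | P r]| = \sum_r (P r : nat).
  by rewrite -sum1dep_card big_mkcond /=; apply: eq_bigr => r _; case: (P r).
split.
  move=> [m [[hedge [g gK _]] [htr hcard]]].
  have ex r : exists d, (m (inl r)).1 = inl d /\ ~~ is_incomp (st r d) /\
      (if (m (inl r)).2 is HalfE then true else false) = is_half (st r d).
    have := hedge (inl r); have := htr r.
    case: (m (inl r)) => [[d|v] k] /= [] -> //=;
      by case e: (st r d) => // _; exists d; rewrite e.
  have [f hf] := fin_all_exists ex.
  exists f; split.
  - move=> r r' e; suff [] : inl r = inl r' :> gleft I by [].
    by apply: (can_inj gK); rewrite (hf r).1 (hf r').1 e.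
  - by move=> r; case: (hf r) => _ [].
  - move: hcard; rewrite cardE.
    by under eq_bigr => r _ do rewrite (hf r).2.2.
move=> [f [finj hcomp hsum]].
pose g r : gright I := inl (f r).
pose C : {set gright I} := ~: (g @: setT).
have cardC : nb I = #|C|.
  have := cardsC (g @: setT); rewrite -/C card_imset.
    rewrite cardsT !card_sum !card_ord; move: #|C| => k; lia.
  by move=> r r' [] /finj.
pose m (u : gleft I) : gright I * ekind :=
  match u with
  | inl r => (inl (f r), if is_half (st r (f r)) then HalfE else CompE)
  | inr k => (enum_val (cast_ord cardC k), Dummy)
  end.
exists m; split; last split.
- split=> [[r|k]|] //=.
    by move: (hcomp r); case e: (st r (f r)) => //= _; rewrite e.
  apply: inj_card_bij; last by rewrite !card_sum !card_ord; lia.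
  have inC k : enum_val (cast_ord cardC k) \in C by exact: enum_valP.
  move=> [r|k] [r'|k'] /=.
  + by case=> /finj ->.
  + by move=> e; have := inC k'; rewrite -e inE (imset_f g) ?inE.
  + by move=> e; have := inC k; rewrite e inE (imset_f g) ?inE.
  + by move=> /enum_val_inj /cast_ord_inj ->.
- by move=> r /=; case: is_half; [right|left].
- rewrite cardE; move: hsum; congr (Order.le _ _).
  by congr Posz; apply: eq_bigr => r _ /=; case: is_half.
Qed.

Definition rows I := enum [set: recipient (np I) (na I)].
Definition cols I := enum [set: donor (np I) (nb I)].
Definition entries I : seq compat :=
  flatten [seq [seq st r d | d <- cols I] | r <- rows I].
Definition entry I i j := nth Incomp (entries I) (i * (np I + nb I) + j).

Lemma size_rows I : size (rows I) = np I + na I.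
Proof. by rewrite -cardE cardsT card_sum !card_ord. Qed.
Lemma size_cols I : size (cols I) = np I + nb I.
Proof. by rewrite -cardE cardsT card_sum !card_ord. Qed.

Lemma nth_flatten_map (S T U : Type) (x0 : S) (y0 : T) (z0 : U) (f : S -> T -> U) s t i j :
  i < size s -> j < size t ->
  nth z0 (flatten [seq [seq f x y | y <- t] | x <- s]) (i * size t + j) =
  f (nth x0 s i) (nth y0 t j).
Proof.
elim: s i => // x s IH [|i] /=; rewrite nth_cat size_map => hi hj.
  by rewrite hj (nth_map y0).
have -> : (i.+1 * size t + j < size t) = false by rewrite mulSn; lia.
by rewrite mulSn -addnA addKn IH.
Qed.

Lemma size_flatten_map (S T U : Type) (f : S -> T -> U) s t :
  size (flatten [seq [seq f x y | y <- t] | x <- s]) = size s * size t.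
Proof. by elim: s => //= x s IH; rewrite size_cat size_map IH mulSn. Qed.

Lemma entryE I r d : entry I (index r (rows I)) (index d (cols I)) = st r d.
Proof.
have hr : r \in rows I by rewrite mem_enum inE.
have hd : d \in cols I by rewrite mem_enum inE.
by rewrite /entry -size_cols (nth_flatten_map r d) ?index_mem // !nth_index.
Qed.

Lemma allKEI_entries (I : instance) (h : nat) : allKEI_yes I h <->
  exists f, good_injection (np I + na I) (np I + nb I) (entry I) h f.
Proof.
rewrite allKEI_yesP -size_rows -size_cols.
have hr r : r \in rows I by rewrite mem_enum inE.
have hd d : d \in cols I by rewrite mem_enum inE.
have ur : uniq (rows I) by apply: enum_uniq.
have uc : uniq (cols I) by apply: enum_uniq.
have sumE (F : nat -> nat) : \sum_(i < size (rows I)) F i = \sum_r F (index r (rows I)).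
  rewrite -[RHS]big_enum /= -(eq_enum (A := [set: _])) ; last by move=> r; rewrite inE.
  rewrite -/(rows I) -(big_mkord xpredT F).
  case e: (rows I) => [|r0 l]; first by rewrite big_geq // big_nil.
  rewrite -e [RHS](big_nth r0) !big_mkord; apply: eq_bigr => i _.
  by rewrite index_uniq.
split.
  move=> [f [finj hcomp hsum]].
  case: (altP (rows I =P [::])) => [e|ne].
    by exists id; split; rewrite ?e //= big_ord0.
  have [r0 _] : exists r0, r0 \in rows I by case: (rows I) ne => // r l; exists r; rewrite mem_head.
  pose rw i := nth r0 (rows I) i.
  have rwK i : i < size (rows I) -> index (rw i) (rows I) = i by move=> ?; rewrite index_uniq.
  exists (fun i => index (f (rw i)) (cols I)); split.
  - split=> [i _|i i' hi hi' e]; first by rewrite index_mem.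
    rewrite -(rwK i) // -(rwK i') //; congr (index _ _); apply: finj.
    by rewrite -[f _](nth_index (f r0) (hd _)) e nth_index.
  - by move=> i hi; rewrite -{1}(rwK i hi) entryE.
  - rewrite (sumE (fun i => is_half (entry I i (index (f (rw i)) (cols I))))).
    apply: leq_trans hsum.
    by apply: leq_sum => r _; rewrite /rw nth_index // entryE.
move=> [f [[frange finj] hcomp hsum]].
have ex r : exists d, index d (cols I) = f (index r (rows I)).
  have := frange (index r (rows I)); rewrite index_mem hr => /(_ isT).
  case: (cols I) uc => // d0 l uc hlt; exists (nth d0 (d0 :: l) (f (index r (rows I)))).
  by rewrite index_uniq.
have [F hF] := fin_all_exists ex.
exists F; split.
- move=> r r' e; have := hF r'; rewrite -e hF => /finj.
  rewrite !index_mem !hr => /(_ isT isT) ei.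
  by rewrite -(nth_index r (hr r)) ei nth_index.
- by move=> r; rewrite -entryE hF hcomp // index_mem.
- rewrite lez_nat; apply: leq_trans hsum.
  rewrite (sumE (fun i => is_half (entry I i (f i)))).
  by apply: leq_sum => r _; rewrite -hF entryE.
Qed.

(** * Decoding *)

Fixpoint binval (l : seq bool) : nat := if l is b :: l' then b + (binval l').*2 else 0.

Lemma bitsFK fuel n : n <= fuel -> binval (bitsF fuel n) = n /\ last true (bitsF fuel n).
Proof.
elim: fuel n => [|f IH] [|n] //= hn.
have hle : uphalf n <= f by lia.
have [-> hl] := IH _ hle; split; first by lia.
have : last true (bitsF f (uphalf n)) by [].
case e: (bitsF f _) (IH _ hle) => [|c l] //= [h0 _] _.
by move: h0 => /esym; case: n {hn hle e hl} => // n; rewrite /=; lia.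
Qed.

Lemma binvalK l fuel : last true l -> binval l <= fuel -> bitsF fuel (binval l) = l.
Proof.
elim: l fuel => [|b l IH] [|f] //=; last first.
  move=> hl hf.
  have hpos : 0 < b + (binval l).*2.
    case: b hl {hf} => //=; rewrite add0n double_gt0; elim: l {IH} => [|c l IHl] //=.
    by case: c => //= /IHl; rewrite add0n double_gt0.
  rewrite (gtn_eqF hpos) oddD odd_double addbF oddb half_bit_double IH //; last by lia.
  by case: l hl {IH hf hpos}.
case: b => //=; rewrite add0n leqn0 double_eq0 => hl /eqP h0.
suff : 0 < binval l by rewrite h0.
elim: l hl {IH h0} => [|c l IHl] //=.
by case: c => //= /IHl; rewrite add0n double_gt0.
Qed.

Lemma binval_bin n : binval (bin n) = n.
Proof. by case: (@bitsFK n n). Qed.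
Lemma last_bin n : last true (bin n).
Proof. by case: (@bitsFK n n). Qed.
Lemma bin_binval l : last true l -> bin (binval l) = l.
Proof. by move=> h; apply: binvalK. Qed.

Definition unary_len (x : seq bool) (k : nat) : nat := find negb (drop k x).

Lemma unary_lenP x k n y : drop k x = unary n ++ y ->
  [/\ unary_len x k = n, k + n < size x & drop (k + n).+1 x = y].
Proof.
move=> e; have hsz := congr1 size e.
rewrite size_drop !size_cat size_nseq /= addn1 in hsz.
split; first by rewrite /unary_len e; elim: n {e hsz} => //= n ->.
  by lia.
have -> : (k + n).+1 = n.+1 + k by lia.
rewrite -drop_drop e drop_cat size_cat size_nseq /= addn1 ltnn subnn drop0 //.
Qed.

Lemma drop_unary_len x k : k + unary_len x k < size x ->
  drop k x = unary (unary_len x k) ++ drop (k + unary_len x k).+1 x.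
Proof.
rewrite /unary_len => h; set n := find negb (drop k x).
have hn : n < size (drop k x) by rewrite size_drop; move: h; rewrite -/n; lia.
have -> : (k + n).+1 = n.+1 + k by lia.
rewrite -drop_drop -[LHS](cat_take_drop n) (drop_nth false hn) /unary -catA /=.
have -> : nth false (drop k x) n = false.
  by apply: negbTE; apply: (nth_find false); rewrite has_find.
congr (_ ++ _ :: _); apply: (@eq_from_nth _ false).
  by rewrite size_takel ?size_nseq // ltnW.
move=> i; rewrite size_takel; last exact: ltnW.
move=> hi; rewrite nth_take // nth_nseq hi.
by apply: negbFE; have := before_find false hi => /= ->.
Qed.

Definition decode (b1 b2 : bool) : compat :=
  if b1 then Incomp else if b2 then HalfComp else Comp.

Lemma enc_compatE c : enc_compat c = [:: is_incomp c; is_half c].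
Proof. by case: c. Qed.

Lemma size_enc_compats cs : size (flatten (map enc_compat cs)) = (size cs).*2.
Proof. by elim: cs => //= c cs IH; rewrite size_cat IH enc_compatE. Qed.

Lemma nth_enc_compats cs y t : t < size cs ->
  nth false (flatten (map enc_compat cs) ++ y) t.*2 = is_incomp (nth Incomp cs t) /\
  nth false (flatten (map enc_compat cs) ++ y) t.*2.+1 = is_half (nth Incomp cs t).
Proof.
elim: cs t => // c cs IH [|t] /=; first by rewrite enc_compatE.
by rewrite ltnS => /IH [h1 h2]; rewrite enc_compatE /= h1 h2.
Qed.

Lemma entries_enc I : flatten [seq flatten [seq enc_compat (st r d) | d <- cols I] | r <- rows I]
  = flatten (map enc_compat (entries I)).
Proof.
rewrite /entries; elim: (rows I) => //= r l ->.
by rewrite map_cat flatten_cat -map_comp.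
Qed.

Lemma size_entries I : size (entries I) = (np I + na I) * (np I + nb I).
Proof. by rewrite size_flatten_map size_rows size_cols. Qed.

Lemma instance_of_entries p q r cs : size cs = (p + q) * (p + r) ->
  exists I, [/\ np I = p, na I = q, nb I = r & entries I = cs].
Proof.
move=> hsz.
pose rs := enum [set: recipient p q]; pose ds := enum [set: donor p r].
pose I := @Instance p q r (fun x y => nth Incomp cs (index x rs * (p + r) + index y ds)).
exists I; split=> //; apply: (@eq_from_nth _ Incomp); first by rewrite size_entries hsz.
rewrite size_entries /= => t ht.
have hb : 0 < p + r by case: (p + r) ht => //; rewrite muln0.
have hi : t %/ (p + r) < size (rows I) by rewrite size_rows /= ltn_divLR.
have hj : t %% (p + r) < size (cols I) by rewrite size_cols /= ltn_mod.
rewrite {1}(divn_eq t (p + r)).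
case er: (rows I) (hi) => [|r0 l] // _; case ec: (cols I) (hj) => [|d0 l'] // _.
rewrite -[X in _ * X + _](size_cols I) (nth_flatten_map r0 d0) //.
rewrite [st _ _]/= -/rs -/ds [nth r0 _ _](_ : _ = nth r0 rs (t %/ (p + r))) //.
rewrite [nth d0 _ _](_ : _ = nth d0 ds (t %% (p + r))) //.
by rewrite !index_uniq ?enum_uniq // -divn_eq.
Qed.

Lemma good_injection_ext a b c c' h f :
  (forall i j, i < a -> j < b -> c i j = c' i j) ->
  good_injection a b c h f -> good_injection a b c' h f.
Proof.
move=> e [[hf1 hf2] h2 h3]; split=> //.
- by move=> i hi; rewrite -e ?hf1 ?h2.
- by under eq_bigr => i _ do rewrite -e ?hf1 //.
Qed.

Section Decoded.
Variable x : seq bool.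
Let bit i := nth false x i.
Definition dec_np := unary_len x 0.
Definition dec_na := unary_len x dec_np.+1.
Definition dec_nb := unary_len x (dec_np.+1 + dec_na).+1.
Definition dec_start := ((dec_np.+1 + dec_na).+1 + dec_nb).+1.
Definition dec_pos i j := dec_start + (i * (dec_np + dec_nb) + j).*2.
Definition dec_entry i j := decode (bit (dec_pos i j)) (bit (dec_pos i j).+1).
Definition dec_end := dec_start + ((dec_np + dec_na) * (dec_np + dec_nb)).*2.
Definition dec_bound := drop dec_end.+1 x.

Definition well_formed : Prop :=
  [/\ [/\ dec_np < size x, dec_np.+1 + dec_na < size x &
          (dec_np.+1 + dec_na).+1 + dec_nb < size x],
      forall i j, i < dec_np + dec_na -> j < dec_np + dec_nb ->
        ~~ (bit (dec_pos i j) && bit (dec_pos i j).+1),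
      dec_end < size x, ~~ bit dec_end & last true dec_bound].

Lemma allKEI_langP : allKEI_lang x <->
  well_formed /\ exists f, good_injection (dec_np + dec_na) (dec_np + dec_nb)
    dec_entry (binval dec_bound) f.
Proof.
split.
  move=> [I [h [ex hyes]]].
  case: h ex hyes => n ex hyes; last first.
    by case/allKEI_yesP: hyes => f [_ _].
  move/allKEI_entries: hyes => [f hf].
  move: ex; rewrite /enc entries_enc -(drop0 x) => /unary_lenP [].
  rewrite -/dec_np add0n => e1 l1 /unary_lenP []; rewrite -e1 -/dec_na => e2 l2.
  rewrite -e2 => /unary_lenP []; rewrite -/dec_nb => e3 l3.
  rewrite -e3 -/dec_start => e4.
  have hsz : size (entries I) = (dec_np + dec_na) * (dec_np + dec_nb).
    by rewrite size_entries e1 e2 e3.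
  have szx : size x = dec_end + (size (bin n)).+1.
    have := congr1 size e4; rewrite size_drop size_cat size_enc_compats hsz /=.
    rewrite /dec_end /dec_start; lia.
  have bitE k : bit (dec_start + k) = nth false (drop dec_start x) k by rewrite nth_drop.
  have entE i j : i < dec_np + dec_na -> j < dec_np + dec_nb ->
      bit (dec_pos i j) = is_incomp (entry I i j) /\
      bit (dec_pos i j).+1 = is_half (entry I i j).
    move=> hi hj; rewrite /dec_pos -addnS !bitE e4 /entry -e1 -e3.
    apply: nth_enc_compats; rewrite hsz; nia.
  have hend : drop dec_end x = false :: bin n.
    rewrite /dec_end addnC -drop_drop e4 -hsz -size_enc_compats.
    by rewrite drop_cat ltnn subnn drop0.
  have hbnd : dec_bound = bin n.
    by rewrite /dec_bound -add1n -drop_drop hend /= drop0.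
  split.
    rewrite /well_formed; split; [split| | | |].
    - by rewrite e1.
    - by rewrite e2.
    - by rewrite e3.
    - by move=> i j hi hj; have [-> ->] := entE i j hi hj; case: (entry I i j).
    - by rewrite szx; lia.
    - by rewrite /bit -[dec_end]addn0 -nth_drop hend.
    - by rewrite hbnd last_bin.
  exists f; rewrite hbnd binval_bin.
  move: hf; rewrite -e1 -e2 -e3; apply: good_injection_ext => i j hi hj.
  by rewrite /dec_entry; have [-> ->] := entE i j hi hj; case: (entry I i j).
case=> [[[l1 l2 l3] hval lend hsign hlast] [f hf]].
pose b := dec_np + dec_nb.
pose cs := mkseq (fun t => decode (bit (dec_start + t.*2)) (bit (dec_start + t.*2).+1))
  ((dec_np + dec_na) * b).
have hcs : size cs = (dec_np + dec_na) * b by rewrite size_mkseq.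
have [I [e1 e2 e3 ecs]] := instance_of_entries hcs.
exists I, (Posz (binval dec_bound)); split; last first.
  apply/allKEI_entries; exists f; rewrite e1 e2 e3.
  apply: good_injection_ext hf => i j hi hj.
  rewrite /entry ecs e1 e3 nth_mkseq //; nia.
rewrite /enc entries_enc ecs e1 e2 e3.
rewrite -{1}(drop0 x) (drop_unary_len (k := 0)) // -/dec_np.
congr (_ ++ _); rewrite (drop_unary_len (k := _.+1)) // -/dec_na.
congr (_ ++ _); rewrite (drop_unary_len (k := _.+1)) // -/dec_nb -/dec_start.
congr (_ ++ _); rewrite -[LHS](cat_take_drop (size cs).*2) drop_drop.
congr (_ ++ _).
  apply: (@eq_from_nth _ false).
    rewrite size_enc_compats size_takel // size_drop hcs.
    by move: lend; rewrite /dec_end /b; lia.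
  move=> i; rewrite size_takel; last first.
    by rewrite size_drop hcs; move: lend; rewrite /dec_end /b; lia.
  move=> hi; rewrite nth_take // nth_drop -(cats0 (flatten _)).
  have ht : i./2 < size cs by lia.
  have [h1 h2] := nth_enc_compats [::] ht.
  have htb := ht; rewrite hcs in htb.
  have hb : 0 < b by case: (b) htb => //; rewrite muln0.
  have hv : ~~ (bit (dec_start + i./2.*2) && bit (dec_start + i./2.*2).+1).
    have := hval (i./2 %/ b) (i./2 %% b); rewrite /dec_pos -/b -divn_eq.
    by apply; rewrite ?ltn_mod // ltn_divLR.
  have nthcs := nth_mkseq Incomp (fun t => decode (bit (dec_start + t.*2)) (bit (dec_start + t.*2).+1)) htb.
  rewrite -/cs in nthcs; rewrite nthcs in h1 h2.
  rewrite -[i]odd_double_half; case: (odd i) => /=; rewrite ?add1n ?add0n ?h1 ?h2 ?addnS -/(bit _).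
    by move: hv; case: bit => //; case: bit.
  by case: bit => //; case: bit.
rewrite addnC hcs -/dec_end (drop_nth false) // -/(bit _) (negPf hsign) /=.
by rewrite bin_binval.
Qed.

End Decoded.

(** * The program *)

Local Notation rZ := 0 (only parsing).
Local Notation rLEN := 1 (only parsing).
Local Notation rPOS := 2 (only parsing).
Local Notation rNP := 3 (only parsing).
Local Notation rNA := 4 (only parsing).
Local Notation rNB := 5 (only parsing).
Local Notation rA := 6 (only parsing).
Local Notation rB := 7 (only parsing).
Local Notation rS1 := 8 (only parsing).
Local Notation rS2 := 9 (only parsing).
Local Notation rW := 10 (only parsing).
Local Notation rND := 11 (only parsing).
Local Notation rT := 12 (only parsing).
Local Notation rU := 13 (only parsing).
Local Notation rI := 14 (only parsing).
Local Notation rJ := 15 (only parsing).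
Local Notation rK := 16 (only parsing).
Local Notation rR := 17 (only parsing).
Local Notation rX := 18 (only parsing).
Local Notation rV := 19 (only parsing).
Local Notation rBV := 20 (only parsing).
Local Notation rBJ := 21 (only parsing).
Local Notation rCNT := 22 (only parsing).
Local Notation rY1 := 23 (only parsing).
Local Notation rY2 := 24 (only parsing).
Local Notation rTMP := 25 (only parsing).

Local Notation aIN := 0 (only parsing).
Local Notation aACC := 2 (only parsing).
Local Notation aBAD := 3 (only parsing).
Local Notation aHALF := 4 (only parsing).
Local Notation aINC := 5 (only parsing).
Local Notation aP := 6 (only parsing).
Local Notation aX := 7 (only parsing).
Local Notation aF := 8 (only parsing).
Local Notation aLAST := 9 (only parsing).

Local Notation "c1 ;; c2" := (Seq c1 c2) (at level 90, right associativity).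

Definition fail := Op (Wr aBAD rZ true).

Definition read_unary n :=
  For rT rLEN (If (Rd aIN rPOS) (Op (Inc n) ;; Op (Inc rPOS)) Skip) ;;
  If (Lt rPOS rLEN) Skip fail ;;
  Op (Inc rPOS).

Definition read_header := read_unary rNP ;; read_unary rNA ;; read_unary rNB.

Definition set_sizes :=
  For rT rNP (Op (Inc rA) ;; Op (Inc rB)) ;;
  For rT rNA (Op (Inc rA)) ;; For rT rNB (Op (Inc rB)) ;;
  Op (Mov rS1 rA) ;; Op (Inc rS1).

Definition set_square := For rT rS1 (For rU rS1 (Op (Inc rS2))).

Definition set_width :=
  For rT rS2 (Op (Inc rW) ;; Op (Inc rW)) ;;
  For rT rA (Op (Inc rW)) ;; For rT rB (Op (Inc rW)) ;;
  Op (Inc rW) ;; Op (Inc rW).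

Definition set_rounds := For rT rB (For rU rW (Op (Inc rND))).

(* Two-dimensional tables are stored row by row, with rows of length [W]. *)
Definition addr i j :=
  Op (Zr rX) ;;
  For rT rW (If (Lt rT i) (For rU rW (Op (Inc rX))) Skip) ;;
  For rT rW (If (Lt rT j) (Op (Inc rX)) Skip).

Definition read_entry :=
  addr rI rJ ;;
  If (Rd aIN rPOS)
    (Op (Wr aINC rX true) ;; Op (Inc rPOS) ;; If (Rd aIN rPOS) fail Skip)
    (Op (Inc rPOS) ;; If (Rd aIN rPOS) (Op (Wr aHALF rX true)) Skip) ;;
  Op (Inc rPOS).

Definition read_matrix := For rI rA (For rJ rB read_entry).

Definition read_sign :=
  If (Lt rPOS rLEN) Skip fail ;; If (Rd aIN rPOS) fail Skip ;; Op (Inc rPOS).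

Definition price_of j :=
  Op (Zr rV) ;; For rK rW (addr j rK ;; If (Rd aP rX) (Op (Inc rV)) Skip).

Definition value :=
  price_of rJ ;; addr rI rJ ;;
  If (Rd aHALF rX) (For rT rS1 (Op (Inc rV))) Skip ;;
  If (Rd aINC rX) (For rT rS2 (Op (Inc rV))) Skip.

Definition find_best :=
  Op (Mov rBV rW) ;;
  For rJ rB (value ;;
    If (Lt rV rBV) (Op (Mov rBV rV) ;; Op (Mov rBJ rJ)) Skip).

Definition free_column := For rK rA (addr rK rBJ ;; Op (Wr aX rX false)).

Definition bid :=
  find_best ;; free_column ;; addr rI rBJ ;; Op (Wr aX rX true) ;;
  price_of rBJ ;; addr rBJ rV ;; Op (Wr aP rX true).

Definition is_assigned :=
  Op (Wr aF rZ false) ;;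
  For rJ rB (addr rI rJ ;; If (Rd aX rX) (Op (Wr aF rZ true)) Skip).

Definition try_bid := is_assigned ;; If (Rd aF rZ) Skip bid.

Definition auction := For rR rND (For rI rA try_bid).

Definition count_half :=
  For rI rA (For rJ rB (addr rI rJ ;;
    If (Rd aX rX)
      (If (Rd aHALF rX) (Op (Inc rCNT)) Skip ;; If (Rd aINC rX) fail Skip)
      Skip)).

(* After [n] rounds of [(y1, y2) := (y2 + 1, y1)] from [(0, 0)],
   [y1] is [uphalf n] and [y2] is [n./2]. *)
Definition halve :=
  Op (Zr rY1) ;; Op (Zr rY2) ;;
  For rT rA (If (Lt rT rCNT)
    (Op (Mov rTMP rY1) ;; Op (Mov rY1 rY2) ;; Op (Inc rY1) ;; Op (Mov rY2 rTMP)) Skip).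

(* [n <= b + 2 m] iff the upper half of [n - b] is at most [m]. *)
Definition compare :=
  Op (Wr aLAST rZ true) ;;
  For rR rLEN (If (Lt rPOS rLEN)
    (halve ;;
     If (Rd aIN rPOS) (Op (Mov rCNT rY2) ;; Op (Wr aLAST rZ true))
                      (Op (Mov rCNT rY1) ;; Op (Wr aLAST rZ false)) ;;
     Op (Inc rPOS))
    Skip).

Definition verdict :=
  If (Lt rB rA) Skip (If (Rd aBAD rZ) Skip (If (Rd aLAST rZ)
    (If (Eq rCNT rZ) (Op (Wr aACC rZ true)) Skip) Skip)).

Definition decide :=
  read_matrix ;; read_sign ;; auction ;; count_half ;; compare ;; verdict.

Definition program :=
  read_header ;; set_sizes ;; set_square ;; set_width ;; set_rounds ;; decide.

Lemma program_polytime : polytime program.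
Proof.
apply: polytime_seq; first by apply: (@polytime_bounded [:: rLEN]).
apply: polytime_seq; first by apply: (@polytime_bounded [:: rNP; rNA; rNB]).
apply: polytime_seq; first by apply: (@polytime_bounded [:: rS1]).
apply: polytime_seq; first by apply: (@polytime_bounded [:: rS2; rA; rB]).
apply: polytime_seq; first by apply: (@polytime_bounded [:: rB; rW]).
by apply: (@polytime_bounded [:: rLEN; rA; rB; rW; rND; rS1; rS2]).
Qed.

Lemma program_ok : code_ok 25 (cmd_code program (Rd aACC rZ)).
Proof. by vm_compute. Qed.

Arguments exec : simpl never.

Lemma exec_skip s : exec Skip s = s. Proof. by []. Qed.
Lemma exec_seq c1 c2 s : exec (c1 ;; c2) s = exec c2 (exec c1 s). Proof. by []. Qed.
Lemma exec_if t c1 c2 s :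
  exec (If t c1 c2) s = if run_test t s then exec c1 s else exec c2 s.
Proof. by []. Qed.

Fact put_key : unit. Proof. exact: tt. Qed.
Definition putr s r v := locked_with put_key (setr s r v).
Definition puta s A i b := locked_with put_key (seta s A i b).
Definition put (o : op) (s : store) : store :=
  match o with
  | Zr r => putr s r 0
  | Inc r => putr s r (rg s r).+1
  | Mov r q => putr s r (rg s q)
  | Wr A r b => puta s A (rg s r) b
  end.

Lemma exec_op o s : exec (Op o) s = put o s.
Proof. by case: o => *; rewrite /= /putr /puta unlock. Qed.
Definition execE := (exec_skip, exec_seq, exec_if, exec_op).

Lemma rg_putr s r v q : rg (putr s r v) q = if q == r then v else rg s q.
Proof. by rewrite /putr unlock. Qed.
Lemma rg_putr_ne s r v q : q != r -> rg (putr s r v) q = rg s q.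
Proof. by rewrite rg_putr => /negPf ->. Qed.
Lemma ar_putr s r v : ar (putr s r v) = ar s.
Proof. by rewrite /putr unlock. Qed.
Lemma rg_puta s A i b : rg (puta s A i b) = rg s.
Proof. by rewrite /puta unlock. Qed.
Lemma ar_puta s A i b A' j :
  ar (puta s A i b) A' j = if (A' == A) && (j == i) then b else ar s A' j.
Proof. by rewrite /puta unlock /= /upd; case: eqP => [->|]. Qed.
Definition storeE := (rg_putr, ar_putr, rg_puta, ar_puta).

Lemma for_rule (Inv : nat -> store -> Prop) p q c s :
  p \notin reg_mods c -> q \notin p :: reg_mods c ->
  Inv 0 (putr s p 0) ->
  (forall k s', k < rg s q -> rg s' p = k ->
     (forall r, r \notin p :: reg_mods c -> rg s' r = rg s r) ->
     (forall A, A \notin arr_mods c -> ar s' A = ar s A) ->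
     Inv k s' -> Inv k.+1 (putr (exec c s') p k.+1)) ->
  Inv (rg s q) (exec (For p q c) s).
Proof.
move=> hp hq h0 hstep; pose F s' := putr (exec c s') p (rg (exec c s') p).+1.
have -> : exec (For p q c) s = iter (rg s q) F (putr s p 0).
  rewrite {1}/exec -/exec /putr unlock; apply: eq_iter => s'.
  by rewrite /F /putr unlock.
have hF k : [/\ rg (iter k F (putr s p 0)) p = k,
     forall r, r \notin p :: reg_mods c -> rg (iter k F (putr s p 0)) r = rg s r &
     forall A, A \notin arr_mods c -> ar (iter k F (putr s p 0)) A = ar s A].
  elim: k => [|k [h1 h2 h3]]; split=> /=.
  - by rewrite rg_putr eqxx.
  - by move=> r; rewrite inE negb_or rg_putr => /andP[/negPf -> _].
  - by move=> A _; rewrite ar_putr.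
  - by rewrite rg_putr eqxx exec_frame_reg ?h1.
  - move=> r hr; rewrite rg_putr; move: (hr); rewrite inE negb_or => /andP[/negPf -> hr'].
    by rewrite exec_frame_reg ?h2.
  - by move=> A hA; rewrite ar_putr exec_frame_arr ?h3.
suff H k : k <= rg s q -> Inv k (iter k F (putr s p 0)) by apply: H.
elim: k => [|k IH] hk; first exact: h0.
have [h1 h2 h3] := hF k.
have := hstep k _ hk h1 h2 h3 (IH (ltnW hk)).
by rewrite iterS {2}/F exec_frame_reg // h1.
Qed.

Lemma exec_inc_loop p q r s : p != r -> q \notin [:: p; r] ->
  rg (exec (For p q (Op (Inc r))) s) r = rg s r + rg s q.
Proof.
move=> hpr hq.
apply: (@for_rule (fun k s' => rg s' r = rg s r + k)) => //.
- by rewrite inE.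
- by rewrite rg_putr eq_sym (negPf hpr) addn0.
- move=> k s' _ _ _ _ e; rewrite execE /= !rg_putr eq_sym (negPf hpr) eqxx e.
  by rewrite addnS.
Qed.

Lemma exec_addr i j s : i \notin [:: rT; rU; rX] -> j \notin [:: rT; rU; rX] ->
  rg s i <= rg s rW -> rg s j <= rg s rW ->
  rg (exec (addr i j) s) rX = rg s i * rg s rW + rg s j.
Proof.
move=> hi hj lei lej.
have [ni nj] : i != rX /\ j != rX.
  by move: hi hj; rewrite !inE !negb_or => /and3P[_ _ ->] /and3P[_ _ ->].
rewrite /addr !execE /=; set s0 := putr s 18 0.
set c1 := For _ _ (If (Lt _ i) _ _); set c2 := For _ _ _.
have f0 r : r != rX -> rg s0 r = rg s r by move=> hr; rewrite rg_putr (negPf hr).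
have z0 : rg s0 rX = 0 by rewrite rg_putr.
move: s0 f0 z0 => s0 f0 z0.
have h1 : rg (exec c1 s0) rX = rg s i * rg s rW.
  pose Inv k s' := rg s' rX = minn k (rg s i) * rg s rW.
  have := @for_rule Inv 12 10 (If (Lt 12 i) (For 13 10 (Op (Inc 18))) Skip) s0 isT isT.
  rewrite -/c1 /Inv min0n mul0n !storeE z0 f0 // => -> //; first by rewrite (minn_idPr lei).
  move=> k s' hk ek fr _ ei; rewrite !execE !storeE /=.
  rewrite ek (fr i hi) (f0 i ni); case: ltnP => hki; last by rewrite ei; congr (_ * _); lia.
  rewrite exec_inc_loop // (fr 10 isT) (f0 10 isT) ei; nia.
have f1 r : r \notin [:: rT; rU; rX] -> rg (exec c1 s0) r = rg s r.
  move=> hr; rewrite exec_frame_reg ?f0 //; first by move: hr; rewrite !inE !negb_or => /and3P[].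
pose Inv k s' := rg s' rX = rg s i * rg s rW + minn k (rg s j).
have := @for_rule Inv 12 10 (If (Lt 12 j) (Op (Inc 18)) Skip) (exec c1 s0) isT isT.
rewrite -/c2 /Inv min0n addn0 !storeE h1 f1 // => -> //; first by rewrite (minn_idPr lej).
move=> k s' hk ek fr _ ei; rewrite !execE !storeE /=.
have hj' : j \notin [:: rT; rX] by move: hj; rewrite !inE !negb_or => /and3P[-> _ ->].
rewrite ek (fr j hj') (f1 j hj).
by case: ltnP => hki; rewrite ?storeE /= ei; lia.
Qed.

(** * Reading the input *)

Lemma unary_len_le x k : unary_len x k <= size x.
Proof.
by rewrite (leq_trans (find_size _ _)) // size_drop leq_subr.
Qed.

Lemma nth_unary_len x k m : nth false x (k + minn m (unary_len x k)) = (m < unary_len x k).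
Proof.
rewrite -nth_drop; case: ltnP => h.
  by apply: negbFE; have := before_find false h => /= ->.
rewrite /unary_len; case: (boolP (has negb (drop k x))) => hh; last first.
  by rewrite (hasNfind hh) nth_default.
by apply: negbTE; apply: (nth_find false hh).
Qed.

Lemma exec_read_unary x n s : n \notin [:: rZ; rLEN; rPOS; rT] ->
  (forall i, ar s aIN i = nth false x i) -> rg s rLEN = size x -> rg s n = 0 ->
  rg s rZ = 0 ->
  let u := unary_len x (rg s rPOS) in
  let s' := exec (read_unary n) s in
  [/\ rg s' n = u, rg s' rPOS = (rg s rPOS + u).+1 &
      ar s' aBAD 0 = ar s aBAD 0 || ~~ (rg s rPOS + u < size x)].
Proof.
move=> hn hIN hlen n0 z0 u; cbv zeta; rewrite /read_unary !execE.
move: hn; rewrite !inE !negb_or => /and4P[nZ nL nP nT].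
have nP' : (rPOS == n) = false by rewrite eq_sym; apply: negbTE.
have nZ' : (rZ == n) = false by rewrite eq_sym; apply: negbTE.
have nL' : (rLEN == n) = false by rewrite eq_sym; apply: negbTE.
have nT' : (rT == n) = false by rewrite eq_sym; apply: negbTE.
set c := For _ _ _.
have [h1 h2] : rg (exec c s) n = minn (rg s rLEN) u /\
    rg (exec c s) rPOS = rg s rPOS + minn (rg s rLEN) u.
  apply: (@for_rule (fun m s' => rg s' n = minn m u /\ rg s' rPOS = rg s rPOS + minn m u)).
  - by rewrite /= !inE nT'.
  - by rewrite /= !inE nL'.
  - by rewrite !storeE (negPf nT) n0 min0n addn0.
  move=> m s' hm _ fr fa [e1 e2]; rewrite !execE /= e2 fa // hIN nth_unary_len.
  case: ltnP => hmu; rewrite !storeE /= ?eqxx ?nP' ?(negPf nT) ?(negPf nP) ?e1 ?e2.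
    by split; lia.
  by split; rewrite ?e1 ?e2; lia.
have hu : minn (rg s rLEN) u = u by apply/minn_idPr; rewrite hlen unary_len_le.
rewrite hu in h1 h2.
have h3 : ar (exec c s) aBAD = ar s aBAD by apply: exec_frame_arr.
have h4 : rg (exec c s) rLEN = size x.
  by rewrite exec_frame_reg // /= !inE nL'.
have h5 : rg (exec c s) rZ = 0.
  by rewrite exec_frame_reg // /= !inE nZ'.
move: (exec c s) h1 h2 h3 h4 h5 => s1 h1 h2 h3 h4 h5 /=.
rewrite h2 h4 !storeE (negPf nP) eqxx.
by case: ltnP => h; rewrite ?storeE ?h5 /= ?h1 ?h2 ?h3 /= ?orbF ?orbT.
Qed.

Lemma exec_read_header x : let s' := exec read_header (init_store x) in
  [/\ rg s' rNP = dec_np x, rg s' rNA = dec_na x, rg s' rNB = dec_nb x,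
      rg s' rPOS = dec_start x &
      ar s' aBAD 0 = ~~ [&& dec_np x < size x, (dec_np x).+1 + dec_na x < size x &
          ((dec_np x).+1 + dec_na x).+1 + dec_nb x < size x]].
Proof.
cbv zeta; rewrite /read_header !exec_seq.
have [e1 e2 e3] := @exec_read_unary x rNP (init_store x) isT (fun=> erefl) erefl erefl erefl.
rewrite -[unary_len _ _]/(dec_np x) in e1 e2 e3.
set s1 := exec (read_unary 3) _ in e1 e2 e3 *.
have f1 r : r \notin [:: rT; rNP; rPOS] -> rg s1 r = rg (init_store x) r.
  by move=> hr; rewrite exec_frame_reg //=; move: hr; rewrite !inE; do !case: (_ == _).
have fa1 A : A != aBAD -> ar s1 A = ar (init_store x) A.
  by move=> hA; rewrite exec_frame_arr //= inE.
have [|||| g1 g2 g3] := @exec_read_unary x rNA s1 isT.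
- by move=> i; rewrite fa1.
- by rewrite f1.
- by rewrite f1.
- by rewrite f1.
rewrite e2 -/(dec_na x) e3 in g1 g2 g3.
set s2 := exec (read_unary 4) _ in g1 g2 g3 *.
have f2 r : r \notin [:: rT; rNA; rPOS] -> rg s2 r = rg s1 r.
  by move=> hr; rewrite exec_frame_reg //=; move: hr; rewrite !inE; do !case: (_ == _).
have fa2 A : A != aBAD -> ar s2 A = ar s1 A.
  by move=> hA; rewrite exec_frame_arr //= inE.
have [|||| k1 k2 k3] := @exec_read_unary x rNB s2 isT.
- by move=> i; rewrite fa2 // fa1.
- by rewrite f2 // f1.
- by rewrite f2 // f1.
- by rewrite f2 // f1.
rewrite g2 -/(dec_nb x) g3 in k1 k2 k3.
have f3 r : r \notin [:: rT; rNB; rPOS] -> rg (exec (read_unary 5) s2) r = rg s2 r.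
  by move=> hr; rewrite exec_frame_reg //=; move: hr; rewrite !inE; do !case: (_ == _).
split=> //.
- by rewrite f3 // f2.
- by rewrite f3.
- by rewrite k3 /= !negb_and orbA.
Qed.

Lemma exec_set_sizes s : rg s rA = 0 -> rg s rB = 0 ->
  let s' := exec set_sizes s in
  [/\ rg s' rA = rg s rNP + rg s rNA, rg s' rB = rg s rNP + rg s rNB &
      rg s' rS1 = (rg s rNP + rg s rNA).+1].
Proof.
move=> a0 b0; cbv zeta; rewrite /set_sizes !execE /put !storeE /=.
set s1 := exec (For _ rNP _) s; set s2 := exec (For _ rNA _) s1.
have [e1 e2] : rg s1 rA = rg s rNP /\ rg s1 rB = rg s rNP.
  apply: (@for_rule (fun k s' => rg s' rA = k /\ rg s' rB = k)) => //.
    by rewrite !storeE.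
  by move=> k s' _ _ _ _ [h1 h2]; rewrite !execE /= !storeE /= h1 h2.
have f1 : rg s1 rNA = rg s rNA by rewrite exec_frame_reg.
have f1' : rg s1 rNB = rg s rNB by rewrite exec_frame_reg.
have h1 : rg s2 rA = rg s rNP + rg s rNA by rewrite exec_inc_loop // e1 f1.
have h2 : rg s2 rB = rg s rNP by rewrite exec_frame_reg.
have h3 : rg s2 rNB = rg s rNB by rewrite exec_frame_reg.
by rewrite exec_inc_loop // exec_frame_reg // h1 h2 h3.
Qed.

Lemma exec_mul_loop q q' r s : q \notin [:: rT; rU; r] -> q' \notin [:: rT; rU; r] ->
  r \notin [:: rT; rU] ->
  rg (exec (For rT q (For rU q' (Op (Inc r)))) s) r = rg s r + rg s q * rg s q'.
Proof.
move=> hq hq' hr.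
have [rT' rU'] : (r == rT) = false /\ (r == rU) = false.
  by move: hr; rewrite !inE; do 2!case: (_ == _).
apply: (@for_rule (fun k s' => rg s' r = rg s r + k * rg s q')) => //.
- by rewrite /= !inE [_ == r]eq_sym rT'.
- by rewrite !storeE rT' addn0.
move=> k s' _ _ fr _ e.
rewrite rg_putr rT' exec_inc_loop ?[rU == r]eq_sym ?rU' //; last first.
  by move: hq'; rewrite !inE; do 3!case: (_ == _).
by rewrite e (fr q' hq') mulSn; lia.
Qed.

Lemma exec_set_width s : rg s rW = 0 ->
  rg (exec set_width s) rW = 2 * rg s rS2 + rg s rA + rg s rB + 2.
Proof.
move=> w0; rewrite /set_width !execE /= !storeE /=.
rewrite exec_inc_loop // exec_inc_loop //.
rewrite [rg (exec (For 12 6 _) _) 7]exec_frame_reg //.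
set s1 := exec _ s.
have -> : rg s1 rA = rg s rA by apply: exec_frame_reg.
have -> : rg s1 rB = rg s rB by apply: exec_frame_reg.
suff -> : rg s1 rW = 2 * rg s rS2 by lia.
apply: (@for_rule (fun k s' => rg s' rW = 2 * k)) => //; first by rewrite !storeE.
by move=> k s' _ _ _ _ e; rewrite !execE /= !storeE /= e; lia.
Qed.

Definition dec_square x := (dec_np x + dec_na x).+1 * (dec_np x + dec_na x).+1.
Definition dec_width x :=
  2 * dec_square x + (dec_np x + dec_na x) + (dec_np x + dec_nb x) + 2.

Record prepared (x : seq bool) (s : store) : Prop := Prepared {
  prep_Z : rg s rZ = 0;
  prep_LEN : rg s rLEN = size x;
  prep_POS : rg s rPOS = dec_start x;
  prep_A : rg s rA = dec_np x + dec_na x;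
  prep_B : rg s rB = dec_np x + dec_nb x;
  prep_S1 : rg s rS1 = (dec_np x + dec_na x).+1;
  prep_S2 : rg s rS2 = dec_square x;
  prep_W : rg s rW = dec_width x;
  prep_ND : rg s rND = (dec_np x + dec_nb x) * dec_width x;
  prep_CNT : rg s rCNT = 0;
  prep_IN : forall i, ar s aIN i = nth false x i;
  prep_BAD : ar s aBAD 0 = ~~ [&& dec_np x < size x, (dec_np x).+1 + dec_na x < size x &
          ((dec_np x).+1 + dec_na x).+1 + dec_nb x < size x];
  prep_arr : forall A i, A != aIN -> A != 1 -> A != aBAD -> ar s A i = false
}.

Lemma exec_prepare x :
  prepared x (exec set_rounds (exec set_width (exec set_square
    (exec set_sizes (exec read_header (init_store x)))))).
Proof.
set s0 := init_store x.
have [a1 a2 a3 a4 a5] := exec_read_header x.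
set s1 := exec read_header s0 in a1 a2 a3 a4 a5 *.
have f1 r : r \notin reg_mods read_header -> rg s1 r = rg s0 r by apply: exec_frame_reg.
have [b1 b2 b3] := exec_set_sizes (f1 rA isT) (f1 rB isT).
set s2 := exec set_sizes s1 in b1 b2 b3 *.
have f2 r : r \notin reg_mods set_sizes -> rg s2 r = rg s1 r by apply: exec_frame_reg.
have c1 : rg (exec set_square s2) rS2 = rg s2 rS2 + rg s2 rS1 * rg s2 rS1.
  by apply: exec_mul_loop.
set s3 := exec set_square s2 in c1 *.
have f3 r : r \notin reg_mods set_square -> rg s3 r = rg s2 r by apply: exec_frame_reg.
have w0 : rg s3 rW = 0 by rewrite f3 // f2 // f1.
have d1 := exec_set_width w0.
set s4 := exec set_width s3 in d1 *.
have f4 r : r \notin reg_mods set_width -> rg s4 r = rg s3 r by apply: exec_frame_reg.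
have e1 : rg (exec set_rounds s4) rND = rg s4 rND + rg s4 rB * rg s4 rW.
  by apply: exec_mul_loop.
set s5 := exec set_rounds s4 in e1 *.
have f5 r : r \notin reg_mods set_rounds -> rg s5 r = rg s4 r by apply: exec_frame_reg.
have fa A : A != aBAD -> ar s5 A = ar s0 A.
  by move=> hA; rewrite !exec_frame_arr //= !inE (negPf hA).
have fb : ar s5 aBAD = ar s1 aBAD.
  by rewrite /s5 exec_frame_arr // /s4 exec_frame_arr // /s3 exec_frame_arr // /s2 exec_frame_arr.
have S2E : rg s3 rS2 = dec_square x.
  by rewrite c1 b3 a1 a2 f2 // f1.
have WE : rg s4 rW = dec_width x.
  by rewrite d1 S2E !f3 // b1 b2 a1 a2 a3 /dec_width.
split.
- by rewrite f5 // f4 // f3 // f2 // f1.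
- by rewrite f5 // f4 // f3 // f2 // f1.
- by rewrite f5 // f4 // f3 // f2.
- by rewrite f5 // f4 // f3 // b1 a1 a2.
- by rewrite f5 // f4 // f3 // b2 a1 a3.
- by rewrite f5 // f4 // f3 // b3 a1 a2.
- by rewrite f5 // f4.
- by rewrite f5.
- by rewrite e1 WE f4 // f3 // f2 // f1 // f4 // f3 // b2 a1 a3.
- by rewrite f5 // f4 // f3 // f2 // f1.
- by move=> i; rewrite fa.
- by rewrite fb.
- by move=> A i h0 h1 h2; rewrite fa //= (negPf h0) (negPf h1).
Qed.

Lemma flat_eq w i j i' j' : j < w -> j' < w ->
  (i * w + j == i' * w + j') = (i == i') && (j == j').
Proof.
move=> hj hj'; apply/eqP/andP => [e|[/eqP -> /eqP ->]] //.
have w0 : 0 < w by lia.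
have := congr1 (divn^~ w) e; rewrite /= !divnMDl // !divn_small // !addn0 => ->.
by have := congr1 (modn^~ w) e; rewrite !modnMDl !modn_small // => ->.
Qed.

Definition matrix_inv (bit : nat -> bool) (bad0 : bool) (a b w k t : nat) (s : store) : Prop :=
  [/\ rg s rPOS = k + t.*2,
      forall i j, i < a -> j < b -> ar s aINC (i * w + j) =
        (i * b + j < t) && bit (k + (i * b + j).*2),
      forall i j, i < a -> j < b -> ar s aHALF (i * w + j) =
        (i * b + j < t) && ~~ bit (k + (i * b + j).*2) && bit (k + (i * b + j).*2).+1 &
      ~~ ar s aBAD 0 <-> ~~ bad0 /\ (forall i j, i < a -> j < b -> i * b + j < t ->
        ~~ (bit (k + (i * b + j).*2) && bit (k + (i * b + j).*2).+1))].

Lemma exec_read_entry bit bad0 a b w k s :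
  (forall i, ar s aIN i = bit i) -> rg s rZ = 0 -> rg s rW = w -> a <= w -> b <= w ->
  rg s rI < a -> rg s rJ < b ->
  matrix_inv bit bad0 a b w k (rg s rI * b + rg s rJ) s ->
  matrix_inv bit bad0 a b w k (rg s rI * b + rg s rJ).+1 (exec read_entry s).
Proof.
move=> hIN z0 hw haw hbw hi hj [e1 e2 e3 e4].
rewrite /read_entry exec_seq.
have hX : rg (exec (addr rI rJ) s) rX = rg s rI * w + rg s rJ.
  by rewrite exec_addr ?hw //; lia.
have fr r : r \notin [:: rX; rT; rU] -> rg (exec (addr rI rJ) s) r = rg s r.
  by move=> hr; rewrite exec_frame_reg //=; move: hr; rewrite !inE; do !case: (_ == _).
have fa A : ar (exec (addr rI rJ) s) A = ar s A by apply: exec_frame_arr.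
have p1 := fr rPOS isT; have z1 := fr rZ isT; clear fr.
move: (exec (addr rI rJ) s) hX fa p1 z1 => s1 hX fa p1 z1.
set i := rg s rI in hi hX e1 e2 e3 e4 *; set j := rg s rJ in hj hX e1 e2 e3 e4 *.
set t := i * b + j in e1 e2 e3 e4 *.
have te i' j' : j' < b -> (i' * b + j' < t.+1) = (i' * b + j' < t) || ((i' == i) && (j' == j)).
  by move=> hj'; rewrite ltnS leq_eqVlt flat_eq // orbC.
have we i' j' : j' < b -> (i' * w + j' == i * w + j) = ((i' == i) && (j' == j)).
  by move=> hj'; rewrite flat_eq //; apply: leq_trans hbw.
have bnext (c : bool) : bit (k + t.*2) && bit (k + t.*2).+1 = c ->
   (~~ ar s 3 0 && ~~ c <-> ~~ bad0 /\ (forall i' j', i' < a -> j' < b -> i' * b + j' < t.+1 ->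
        ~~ (bit (k + (i' * b + j').*2) && bit (k + (i' * b + j').*2).+1))).
  move=> hc; split.
    case/andP=> /e4 [h1 h2] h3; split=> // i' j' hi' hj'; rewrite te // => /orP[|/andP[/eqP -> /eqP ->]].
      exact: h2.
    by rewrite -/t hc.
  move=> [h1 h2]; apply/andP; split; last by rewrite -hc; apply: h2.
  by apply/e4; split=> // i' j' hi' hj' h; apply: h2 => //; apply: ltnW.
have posE : rg s1 2 = k + t.*2 by rewrite p1.
have fin s' :
    (forall i' j', i' < a -> j' < b -> ar s' aINC (i' * w + j') =
        if (i' == i) && (j' == j) then bit (k + t.*2) else ar s aINC (i' * w + j')) ->
    (forall i' j', i' < a -> j' < b -> ar s' aHALF (i' * w + j') =
        if (i' == i) && (j' == j) then ~~ bit (k + t.*2) && bit (k + t.*2).+1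
        else ar s aHALF (i' * w + j')) ->
    ~~ ar s' aBAD 0 = ~~ ar s aBAD 0 && ~~ (bit (k + t.*2) && bit (k + t.*2).+1) ->
    matrix_inv bit bad0 a b w k t.+1 (putr s' rPOS (k + t.*2).+2).
  move=> q2 q3 q4; split; rewrite !storeE /=.
  - by rewrite doubleS; lia.
  - move=> i' j' hi' hj'; rewrite q2 // te // e2 //.
    by case: eqP => [->|_]; case: eqP => [->|_]; rewrite ?orbF ?orbT //= -/t ?ltnn.
  - move=> i' j' hi' hj'; rewrite q3 // te // e3 //.
    by case: eqP => [->|_]; case: eqP => [->|_]; rewrite ?orbF ?orbT //= -/t ?ltnn.
  - by rewrite q4; apply: bnext.
have ninc : ar s aINC (i * w + j) = false by rewrite e2 // ltnn.
have nhalf : ar s aHALF (i * w + j) = false by rewrite e3 // ltnn.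
have eqij i' j' : (i' == i) && (j' == j) -> i' = i /\ j' = j by case/andP=> /eqP -> /eqP ->.
rewrite !execE [run_test _ s1]/= fa posE hIN.
case: ifP => hb1 /=.
  rewrite !storeE /= fa hIN posE.
  case: ifP => hb2; rewrite ?execE /= ?storeE /= ?posE; apply: fin.
  - by move=> i' j' hi' hj'; rewrite !storeE /= hX we // fa hb1.
  - by move=> i' j' hi' hj'; rewrite !storeE /= fa hb1 /=; case: ifP => // /eqij[-> ->].
  - by rewrite !storeE /= z1 z0 hb1 hb2 andbF.
  - by move=> i' j' hi' hj'; rewrite !storeE /= hX we // fa hb1.
  - by move=> i' j' hi' hj'; rewrite !storeE /= fa hb1 /=; case: ifP => // /eqij[-> ->].
  - by rewrite !storeE /= fa hb1 hb2 andbT.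
rewrite !storeE /= fa hIN posE.
case: ifP => hb2; rewrite ?execE /= ?storeE /= ?posE; apply: fin.
- by move=> i' j' hi' hj'; rewrite !storeE /= fa hb1 /=; case: ifP => // /eqij[-> ->].
- by move=> i' j' hi' hj'; rewrite !storeE /= hX we // fa hb1 hb2.
- by rewrite !storeE /= fa hb1 andbT.
- by move=> i' j' hi' hj'; rewrite !storeE /= fa hb1 /=; case: ifP => // /eqij[-> ->].
- by move=> i' j' hi' hj'; rewrite !storeE /= fa hb1 hb2 /=; case: ifP => // /eqij[-> ->].
- by rewrite !storeE /= fa hb1 andbT.
Qed.

Lemma matrix_inv_putr bit bad0 a b w k t s r v : r != rPOS ->
  matrix_inv bit bad0 a b w k t s -> matrix_inv bit bad0 a b w k t (putr s r v).
Proof.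
by move=> hr [h1 h2 h3 h4]; split; rewrite ?ar_putr // rg_putr eq_sym (negPf hr).
Qed.

Lemma exec_read_matrix bit a b w s :
  (forall i, ar s aIN i = bit i) -> rg s rZ = 0 -> rg s rW = w ->
  rg s rA = a -> rg s rB = b -> a <= w -> b <= w ->
  (forall i, ar s aINC i = false) -> (forall i, ar s aHALF i = false) ->
  matrix_inv bit (ar s aBAD 0) a b w (rg s rPOS) (a * b) (exec read_matrix s).
Proof.
move=> hIN z0 hw ha hb haw hbw n1 n2.
rewrite -[X in X * b]ha.
apply: (@for_rule (fun i => matrix_inv bit (ar s aBAD 0) a b w (rg s rPOS) (i * b))) => //.
  apply: matrix_inv_putr => //; split; rewrite ?addn0 //.
  by split=> // -[].
move=> i s' hi ei fr fa inv.
apply: matrix_inv_putr => //.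
rewrite mulSn addnC -[X in _ + X]hb -(fr rB isT).
apply: (@for_rule (fun j => matrix_inv bit (ar s aBAD 0) a b w (rg s rPOS) (i * b + j))) => //.
  by apply: matrix_inv_putr; rewrite ?addn0.
move=> j s'' hj ej fr' fa' inv'.
apply: matrix_inv_putr => //; rewrite addnS.
rewrite (fr rB isT) hb in hj; rewrite ha in hi.
have eI : rg s'' rI = i by rewrite fr'.
rewrite -{1}eI -ej; apply: exec_read_entry; rewrite ?eI ?ej //.
- by move=> l; rewrite fa' // fa.
- by rewrite fr' // fr.
- by rewrite fr' // fr.
Qed.

(** * Running the auction *)

Record market (a b w : nat) (c : nat -> nat -> compat) (s : store) : Prop := Market {
  market_Z : rg s rZ = 0;
  market_A : rg s rA = a;
  market_B : rg s rB = b;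
  market_S1 : rg s rS1 = a.+1;
  market_S2 : rg s rS2 = a.+1 * a.+1;
  market_W : rg s rW = w;
  market_half : forall i j, i < a -> j < b -> ar s aHALF (i * w + j) = is_half (c i j);
  market_inc : forall i j, i < a -> j < b -> ar s aINC (i * w + j) = is_incomp (c i j)
}.

Definition market_regs := [:: rZ; rA; rB; rS1; rS2; rW].

Lemma market_ext a b w c s s' : (forall r, r \in market_regs -> rg s' r = rg s r) ->
  ar s' aHALF = ar s aHALF -> ar s' aINC = ar s aINC ->
  market a b w c s -> market a b w c s'.
Proof.
move=> hr h1 h2 [m1 m2 m3 m4 m5 m6 m7 m8].
by split; rewrite ?h1 ?h2 // ?hr ?inE.
Qed.

Definition spares_market (m : cmd) : bool :=
  [&& all (fun r => r \notin reg_mods m) market_regs, aHALF \notin arr_mods m &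
      aINC \notin arr_mods m].

Lemma market_exec a b w c m s : spares_market m -> market a b w c s ->
  market a b w c (exec m s).
Proof.
case/and3P=> /allP hr h1 h2; apply: market_ext; rewrite ?exec_frame_arr //.
by move=> r /hr; apply: exec_frame_reg.
Qed.

Lemma market_putr a b w c s r v : r \notin market_regs -> market a b w c s ->
  market a b w c (putr s r v).
Proof.
move=> hr; apply: market_ext; rewrite ?ar_putr // => q hq; rewrite rg_putr.
by case: eqP hq hr => // -> ->.
Qed.

Definition ledger (a b w : nat) (p : nat -> nat) (X : nat -> nat -> bool) (s : store) : Prop :=
  (forall j t, j < b -> t < w -> ar s aP (j * w + t) = (t < p j)) /\
  (forall i j, i < a -> j < b -> ar s aX (i * w + j) = X i j).

Lemma ledger_ext a b w p X s s' : ar s' aP = ar s aP -> ar s' aX = ar s aX ->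
  ledger a b w p X s -> ledger a b w p X s'.
Proof. by move=> h1 h2 [l1 l2]; split; rewrite ?h1 ?h2. Qed.

Lemma exec_price_of j s q : j \notin [:: rT; rU; rX; rV; rK] -> rg s j <= rg s rW ->
  q <= rg s rW -> (forall t, t < rg s rW -> ar s aP (rg s j * rg s rW + t) = (t < q)) ->
  rg (exec (price_of j) s) rV = q.
Proof.
move=> hj lej leq hP; rewrite /price_of exec_seq exec_op /put.
move: (hj); rewrite !inE !negb_or => /and5P[jT jU jX jV jK].
set s0 := putr s rV 0.
have h0 : rg s0 rV = 0 by rewrite rg_putr.
have f0 r : r != rV -> rg s0 r = rg s r by move=> hr; rewrite rg_putr (negPf hr).
have fa0 A : ar s0 A = ar s A by rewrite ar_putr.
move: s0 h0 f0 fa0 => s0 h0 f0 fa0.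
rewrite -[RHS](minn_idPr (leq : q <= rg s rW)) -(f0 rW isT).
apply: (@for_rule (fun k s' => rg s' rV = minn k q)) => //.
  by rewrite !storeE /= h0 min0n.
move=> k s' hk ek fr fa inv.
rewrite rg_putr exec_seq execE /=.
have fj : rg s' j = rg s j.
  by rewrite fr ?f0 //= !inE !negb_or jT jU jX jV jK.
have fW : rg s' rW = rg s rW by rewrite fr ?f0.
have hk' : k < rg s rW by rewrite -(f0 rW isT).
have hX : rg (exec (addr j rK) s') rX = rg s j * rg s rW + k.
  rewrite exec_addr ?fj ?fW ?ek //; last exact: ltnW.
  by rewrite !inE !negb_or jT jU jX.
have hV : rg (exec (addr j rK) s') rV = minn k q by rewrite exec_frame_reg.
have hA : ar (exec (addr j rK) s') aP = ar s aP.
  by rewrite exec_frame_arr // fa // fa0.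
move: (exec (addr j rK) s') hX hV hA => s1 hX hV hA.
by rewrite execE /put /= hA hX hP //; case: ltnP => h; rewrite ?execE ?storeE /= hV; lia.
Qed.

Lemma exec_value a b w c p X s : market a b w c s -> ledger a b w p X s ->
  a <= w -> b <= w -> rg s rI < a -> rg s rJ < b -> p (rg s rJ) <= w ->
  rg (exec value s) rV = weight a (c (rg s rI) (rg s rJ)) + p (rg s rJ).
Proof.
move=> mk [l1 l2] haw hbw hi hj hp.
set i := rg s rI in hi *; set j := rg s rJ in hj hp *.
rewrite /value exec_seq exec_seq.
have e1 : rg (exec (price_of rJ) s) rV = p j.
  apply: exec_price_of; rewrite ?(market_W mk) //; first exact: ltnW (leq_trans hj hbw).
  by move=> t ht; rewrite l1.
have mk1 : market a b w c (exec (price_of rJ) s) by apply: market_exec mk.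
have i1 : rg (exec (price_of rJ) s) rI = i by rewrite exec_frame_reg.
have j1 : rg (exec (price_of rJ) s) rJ = j by rewrite exec_frame_reg.
move: (exec (price_of rJ) s) e1 mk1 i1 j1 => s1 e1 mk1 i1 j1.
have hX : rg (exec (addr rI rJ) s1) rX = i * w + j.
  by rewrite exec_addr ?i1 ?j1 ?(market_W mk1) //; apply: ltnW; [apply: leq_trans haw | apply: leq_trans hbw].
have mk2 : market a b w c (exec (addr rI rJ) s1) by apply: market_exec mk1.
have e2 : rg (exec (addr rI rJ) s1) rV = p j by rewrite exec_frame_reg.
move: (exec (addr rI rJ) s1) hX mk2 e2 => s2 hX mk2 e2.
rewrite exec_seq.
set s3 := exec (If _ _ _) s2.
have mk3 : market a b w c s3 by apply: market_exec mk2.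
have X3 : rg s3 rX = i * w + j by rewrite exec_frame_reg.
have e3 : rg s3 rV = a.+1 * is_half (c i j) + p j.
  rewrite /s3 exec_if /= hX (market_half mk2) //.
  case: is_half; last by rewrite execE e2; lia.
  by rewrite exec_inc_loop // e2 (market_S1 mk2); lia.
move: s3 mk3 X3 e3 => s3 mk3 X3 e3.
rewrite exec_if /= X3 (market_inc mk3) // /weight mulnDr mulnA.
case: is_incomp; last by rewrite execE e3 muln0 addn0.
by rewrite exec_inc_loop // e3 (market_S2 mk3) muln1; lia.
Qed.

Lemma exec_find_best a b w c p X s : market a b w c s -> ledger a b w p X s ->
  a <= w -> b <= w -> rg s rI < a -> 0 < b ->
  (forall j, j < b -> weight a (c (rg s rI) j) + p j < w) ->
  exists2 j, j < b & rg (exec find_best s) rBJ = j /\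
    forall k, k < b -> weight a (c (rg s rI) j) + p j <= weight a (c (rg s rI) k) + p k.
Proof.
move=> mk lg haw hbw hi hb hv; rewrite /find_best exec_seq exec_op /put.
set i := rg s rI in hi hv *.
pose v j := weight a (c i j) + p j.
set s0 := putr s _ _.
have mk0 : market a b w c s0 by apply: market_putr mk.
have lg0 : ledger a b w p X s0 by apply: ledger_ext lg; rewrite ar_putr.
have i0 : rg s0 rI = i by rewrite rg_putr.
have bv0 : rg s0 rBV = w by rewrite rg_putr (market_W mk).
move: s0 mk0 lg0 i0 bv0 => s0 mk0 lg0 i0 bv0.
pose Inv k s' := (k = 0 /\ rg s' rBV = w) \/
  exists2 j, j < k & [/\ rg s' rBJ = j, rg s' rBV = v j & forall l, l < k -> v j <= v l].
suff : Inv (rg s0 rB) (exec (For rJ rB (value ;;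
    If (Lt rV rBV) (Op (Mov rBV rV) ;; Op (Mov rBJ rJ)) Skip)) s0).
  rewrite (market_B mk0) => -[[e _]|[j hj [h1 h2 h3]]]; first by rewrite e in hb.
  by exists j => //; split.
apply: for_rule => //; first by left; rewrite !storeE /= bv0.
rewrite (market_B mk0) => k s' hk ek fr fa inv.
rewrite exec_seq.
have mk1 : market a b w c s'.
  apply: market_ext mk0; rewrite ?fa // => r hr; apply: fr.
  by move: hr; rewrite !inE => /or3P[/eqP->|/eqP->|/or4P[]/eqP->].
have lg1 : ledger a b w p X s' by apply: ledger_ext lg0; rewrite ?fa.
have i1 : rg s' rI = i by rewrite fr.
have e1 : rg (exec value s') rV = v k.
  have := @exec_value a b w c p X s' mk1 lg1 haw hbw.
  rewrite i1 ek => ->; rewrite ?ek ?i1 //.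
  by apply: ltnW; apply: leq_ltn_trans (hv k hk); rewrite leq_addl.
have e2 : rg (exec value s') rBV = rg s' rBV by rewrite exec_frame_reg.
have e3 : rg (exec value s') rBJ = rg s' rBJ by rewrite exec_frame_reg.
have e4 : rg (exec value s') rJ = k by rewrite exec_frame_reg.
move: (exec value s') e1 e2 e3 e4 => s1 e1 e2 e3 e4.
rewrite !execE /put /= e1 e2 /Inv; right.
case: inv => [[k0 hbv]|[j hj [h1 h2 h3]]].
  rewrite hbv (hv k hk); exists k => //; rewrite !storeE /= e4; split=> //.
  by rewrite k0 => -[].
rewrite h2; case: ltnP => hlt.
  exists k => //; rewrite !storeE /= e4; split=> // l.
  rewrite ltnS leq_eqVlt => /orP[/eqP -> //|/h3]; lia.
exists j; first exact: ltnW.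
rewrite !storeE /= e2 e3; split=> // l.
by rewrite ltnS leq_eqVlt => /orP[/eqP -> //|/h3].
Qed.

Lemma exec_free_column a b w c X s : market a b w c s -> a <= w -> b <= w -> rg s rBJ < b ->
  (forall i j, i < a -> j < b -> ar s aX (i * w + j) = X i j) ->
  forall i j, i < a -> j < b -> ar (exec free_column s) aX (i * w + j) =
    (j != rg s rBJ) && X i j.
Proof.
move=> mk haw hbw hbj hX i j hi hj.
suff : forall i j, i < a -> j < b -> ar (exec free_column s) aX (i * w + j) =
    if (i < rg s rA) && (j == rg s rBJ) then false else X i j.
  by move=> ->; rewrite // (market_A mk) hi /=; case: eqP.
apply: (@for_rule (fun k s' => forall i j, i < a -> j < b -> ar s' aX (i * w + j) =
    if (i < k) && (j == rg s rBJ) then false else X i j)) => //.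
  by move=> i' j' hi' hj'; rewrite ar_putr hX.
rewrite (market_A mk) => k s' hk ek fr fa inv i' j' hi' hj'.
rewrite ar_putr exec_seq.
have fj : rg s' rBJ = rg s rBJ by rewrite fr.
have fw : rg s' rW = w by rewrite fr // (market_W mk).
have eX : rg (exec (addr rK rBJ) s') rX = k * w + rg s rBJ.
  by rewrite exec_addr ?fj ?fw ?ek //; apply: ltnW; [apply: leq_trans haw | apply: leq_trans hbw].
have eA : ar (exec (addr rK rBJ) s') aX = ar s' aX by apply: exec_frame_arr.
move: (exec (addr rK rBJ) s') eX eA => s1 eX eA.
rewrite execE /put ar_puta eX eA /= flat_eq ?(leq_trans hj' hbw) ?(leq_trans hbj hbw) //.
rewrite inv // ltnS [i' <= k]leq_eqVlt; case: (i' == k); case: (j' == _) => //=.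
by rewrite !andbF.
Qed.

Lemma exec_bid a b w c p X s : market a b w c s -> ledger a b w p X s ->
  a <= w -> b <= w -> rg s rI < a -> 0 < b ->
  (forall j, j < b -> weight a (c (rg s rI) j) + p j < w) ->
  exists j, [/\ j < b,
    forall k, k < b -> weight a (c (rg s rI) j) + p j <= weight a (c (rg s rI) k) + p k &
    ledger a b w (upd p j (p j).+1) (assign X (rg s rI) j) (exec bid s)].
Proof.
move=> mk lg haw hbw hi hb hv.
have [j hj [ej hmin]] := exec_find_best mk lg haw hbw hi hb hv.
exists j; split=> //.
have hjw : j < w by apply: leq_trans hbw.
have hpj : p j < w by apply: leq_ltn_trans (hv j hj); rewrite leq_addl.
rewrite /bid exec_seq.
have mk1 : market a b w c (exec find_best s) by apply: market_exec mk.
have lg1 : ledger a b w p X (exec find_best s) by apply: ledger_ext lg; apply: exec_frame_arr.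
have i1 : rg (exec find_best s) rI = rg s rI by apply: exec_frame_reg.
move: (exec find_best s) ej mk1 lg1 i1 => s1 ej mk1 lg1 i1; rewrite exec_seq.
have X2 := exec_free_column mk1 haw hbw; rewrite ej in X2.
have {}X2 := X2 X hj lg1.2.
have mk2 : market a b w c (exec free_column s1) by apply: market_exec mk1.
have P2 : ar (exec free_column s1) aP = ar s1 aP by apply: exec_frame_arr.
have i2 : rg (exec free_column s1) rI = rg s rI by rewrite exec_frame_reg.
have j2 : rg (exec free_column s1) rBJ = j by rewrite exec_frame_reg.
move: (exec free_column s1) X2 mk2 P2 i2 j2 => s2 X2 mk2 P2 i2 j2; rewrite exec_seq.
have hX3 : rg (exec (addr rI rBJ) s2) rX = rg s rI * w + j.
  by rewrite exec_addr ?i2 ?j2 ?(market_W mk2) //; apply: ltnW => //; apply: leq_trans haw.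
have mk3 : market a b w c (exec (addr rI rBJ) s2) by apply: market_exec mk2.
have a3 A : ar (exec (addr rI rBJ) s2) A = ar s2 A by apply: exec_frame_arr.
have j3 : rg (exec (addr rI rBJ) s2) rBJ = j by rewrite exec_frame_reg.
move: (exec (addr rI rBJ) s2) hX3 mk3 a3 j3 => s3 hX3 mk3 a3 j3.
rewrite exec_seq exec_op /put.
set s4 := puta _ _ _ _.
have mk4 : market a b w c s4.
  case: mk3 => m1 m2 m3 m4 m5 m6 m7 m8.
  by split; rewrite ?rg_puta // => i' j' hi' hj'; rewrite ar_puta /= ?m7 ?m8.
have j4 : rg s4 rBJ = j by rewrite rg_puta.
have P4 t : t < w -> ar s4 aP (j * w + t) = (t < p j).
  by move=> ht; rewrite ar_puta /= a3 P2 lg1.1.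
have X4 i' j' : i' < a -> j' < b -> ar s4 aX (i' * w + j') = assign X (rg s rI) j i' j'.
  move=> hi' hj'; rewrite ar_puta /= hX3 a3 X2 // flat_eq //; last exact: leq_trans hbw.
  by rewrite /assign; case: (j' =P j) => [->|_]; rewrite ?andbT ?andbF //=; case: eqP.
have P4' j' t : j' < b -> t < w -> ar s4 aP (j' * w + t) = (t < p j').
  by move=> hj' ht; rewrite ar_puta /= a3 P2 lg1.1.
move: s4 mk4 j4 P4 X4 P4' => s4 mk4 j4 P4 X4 P4'.
rewrite exec_seq.
have V5 : rg (exec (price_of rBJ) s4) rV = p j.
  apply: exec_price_of; rewrite ?j4 ?(market_W mk4) //; exact: ltnW.
have W5 : rg (exec (price_of rBJ) s4) rW = w by rewrite exec_frame_reg // (market_W mk4).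
have j5 : rg (exec (price_of rBJ) s4) rBJ = j by rewrite exec_frame_reg.
have a5 A : ar (exec (price_of rBJ) s4) A = ar s4 A by apply: exec_frame_arr.
move: (exec (price_of rBJ) s4) V5 W5 j5 a5 => s5 V5 W5 j5 a5.
rewrite exec_seq exec_op /put.
have hX6 : rg (exec (addr rBJ rV) s5) rX = j * w + p j.
  by rewrite exec_addr ?j5 ?V5 ?W5 //; apply: ltnW.
have a6 A : ar (exec (addr rBJ rV) s5) A = ar s5 A by apply: exec_frame_arr.
split=> [j' t hj' ht|i' j' hi' hj']; rewrite ar_puta /= a6 a5 ?X4 //.
rewrite hX6 flat_eq // P4' // /upd; case: (j' =P j) => [->|_] //=.
by rewrite ltnS; case: ltngtP.
Qed.

Lemma has_iotaS (P : pred nat) k : has P (iota 0 k.+1) = has P (iota 0 k) || P k.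
Proof. by rewrite -addn1 iotaD has_cat /= orbF. Qed.

Lemma has_iotaP (P : pred nat) k : reflect (exists2 j, j < k & P j) (has P (iota 0 k)).
Proof.
by apply: (iffP hasP) => -[j hj hP]; exists j => //; move: hj; rewrite mem_iota.
Qed.

Lemma exec_is_assigned a b w c p X s : market a b w c s -> ledger a b w p X s ->
  a <= w -> b <= w -> rg s rI < a ->
  ar (exec is_assigned s) aF 0 = has (X (rg s rI)) (iota 0 b).
Proof.
move=> mk lg haw hbw hi; rewrite /is_assigned exec_seq exec_op /put.
set i := rg s rI in hi *.
set s0 := puta _ _ _ _.
have mk0 : market a b w c s0.
  case: mk => m1 m2 m3 m4 m5 m6 m7 m8.
  by split; rewrite ?rg_puta // => i' j' hi' hj'; rewrite ar_puta /= ?m7 ?m8.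
have X0 i' j' : i' < a -> j' < b -> ar s0 aX (i' * w + j') = X i' j'.
  by move=> hi' hj'; rewrite ar_puta /= lg.2.
have i0 : rg s0 rI = i by rewrite rg_puta.
have F0 : ar s0 aF 0 = false by rewrite ar_puta (market_Z mk).
move: s0 mk0 X0 i0 F0 => s0 mk0 X0 i0 F0.
rewrite -[b in iota 0 b](market_B mk0).
apply: (@for_rule (fun k s' => ar s' aF 0 = has (X i) (iota 0 k))) => //.
  by rewrite ar_putr.
rewrite (market_B mk0) => k s' hk ek fr fa inv.
rewrite ar_putr exec_seq.
have i1 : rg s' rI = i by rewrite fr.
have w1 : rg s' rW = w by rewrite fr // (market_W mk0).
have hX : rg (exec (addr rI rJ) s') rX = i * w + k.
  by rewrite exec_addr ?i1 ?ek ?w1 //; apply: ltnW; [apply: leq_trans haw | apply: leq_trans hbw].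
have a1 A : ar (exec (addr rI rJ) s') A = ar s' A by apply: exec_frame_arr.
have z1 : rg (exec (addr rI rJ) s') rZ = 0.
  by rewrite exec_frame_reg // fr // (market_Z mk0).
move: (exec (addr rI rJ) s') hX a1 z1 => s1 hX a1 z1.
rewrite !execE /put [run_test _ _]/= hX a1 fa // X0 // has_iotaS.
by case: (X i k); rewrite ?ar_puta ?z1 /= ?orbT ?orbF ?a1.
Qed.

Definition full (a b : nat) (X : nat -> nat -> bool) : Prop :=
  forall i, i < a -> exists2 j, j < b & X i j.

Lemma exec_try_bid a b w c p X s : let M := a.+1 * a.+1 in
  market a b w c s -> ledger a b w p X s ->
  auction_inv a b (fun i j => weight a (c i j)) M p X ->
  a <= b -> b <= w -> 2 * M + 1 < w -> rg s rI < a ->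
  exists p' X', [/\ ledger a b w p' X' (exec try_bid s),
    auction_inv a b (fun i j => weight a (c i j)) M p' X' &
    if has (X (rg s rI)) (iota 0 b) then p' = p /\ X' = X
    else \sum_(k < b) p' k = (\sum_(k < b) p k).+1].
Proof.
move=> M mk lg inv hab hbw hw hi; rewrite /try_bid exec_seq.
have haw : a <= w by apply: leq_trans hbw.
have hF := exec_is_assigned mk lg haw hbw hi.
have mk1 : market a b w c (exec is_assigned s) by apply: market_exec mk.
have lg1 : ledger a b w p X (exec is_assigned s).
  by apply: ledger_ext lg; apply: exec_frame_arr.
have i1 : rg (exec is_assigned s) rI = rg s rI by apply: exec_frame_reg.
move: (exec is_assigned s) hF mk1 lg1 i1 => s1 hF mk1 lg1 i1.
rewrite exec_if [run_test _ _]/= (market_Z mk1) hF.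
case: has_iotaP => hX; first by exists p, X.
have hb : 0 < b by apply: leq_trans hab; apply: leq_ltn_trans hi.
have hv j : j < b -> weight a (c (rg s1 rI) j) + p j < w.
  move=> hj; have := auction_price inv hj; have := weight_le a (c (rg s1 rI) j).
  by rewrite -/M; lia.
have hi1 : rg s1 rI < a by rewrite i1.
have [j [hj hmin lg2]] := exec_bid mk1 lg1 haw hbw hi1 hb hv.
rewrite i1 in hmin lg2.
exists (upd p j (p j).+1), (assign X (rg s rI) j); split=> //; last exact: sum_upd.
apply: auction_bid => //; first by move=> *; apply: weight_le.
by move=> j' hj'; apply/negP => h; apply: hX; exists j'.
Qed.

Lemma exec_auction a b w c s : let M := a.+1 * a.+1 in
  market a b w c s -> rg s rND = b * w ->
  (forall i, ar s aP i = false) -> (forall i, ar s aX i = false) ->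
  a <= b -> b <= w -> 2 * M + 1 < w ->
  exists p X, [/\ ledger a b w p X (exec auction s),
    auction_inv a b (fun i j => weight a (c i j)) M p X & full a b X].
Proof.
move=> M mk hND hP hX hab hbw hw.
pose good p X s' := ledger a b w p X s' /\
  auction_inv a b (fun i j => weight a (c i j)) M p X.
have good_putr p X s' r v : good p X s' -> good p X (putr s' r v).
  by move=> [h1 h2]; split=> //; apply: ledger_ext h1; rewrite ar_putr.
have fullP X : full a b X \/ exists2 i, i < a & ~~ has (X i) (iota 0 b).
  case: (has_iotaP (fun i => ~~ has (X i) (iota 0 b)) a) => h; first by right.
  by left=> i hi; apply/has_iotaP; apply/negPn/negP => hn; apply: h; exists i.
have H : exists p X, good p X (exec auction s) /\ (full a b X \/ rg s rND <= \sum_(k < b) p k).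
  apply: (@for_rule (fun r s' => exists p X, good p X s' /\ (full a b X \/ r <= \sum_(k < b) p k))) => //.
    exists (fun=> 0), (fun _ _ => false); split; last by right.
    apply: good_putr; split; split=> // *; by rewrite ?hP ?hX.
  move=> r s' _ _ fr fa [p [X [hg hr]]].
  have mk1 : market a b w c s'.
    apply: market_ext mk; rewrite ?fa // => q hq; apply: fr.
    by move: hq; rewrite !inE => /or3P[/eqP->|/eqP->|/or4P[]/eqP->].
  pose Inv k s'' := exists p X, good p X s'' /\
    [\/ full a b X, exists2 i, k <= i < a & ~~ has (X i) (iota 0 b) /\ r <= \sum_(k < b) p k |
        r < \sum_(k < b) p k].
  suff : Inv (rg s' rA) (exec (For rI rA try_bid) s').
    rewrite (market_A mk1) => -[p' [X' [hg' h]]]; exists p', X'.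
    split; first exact: good_putr.
    by case: h => [|[i hi _]|]; [left|lia|right].
  apply: for_rule => //.
    exists p, X; split; first exact: good_putr.
    case: (fullP X) => [|[i hi hn]]; first by constructor 1.
    by case: hr => [|hr]; [constructor 1|constructor 2; exists i].
  rewrite (market_A mk1) => k s'' hk ek fr' fa' [p1 [X1 [[lg1 inv1] hcase]]].
  have mk2 : market a b w c s''.
    apply: market_ext mk1; rewrite ?fa' // => q hq; apply: fr'.
    by move: hq; rewrite !inE => /or3P[/eqP->|/eqP->|/or4P[]/eqP->].
  have [|p2 [X2 [lg2 inv2 h2]]] := exec_try_bid mk2 lg1 inv1 hab hbw hw; first by rewrite ek.
  exists p2, X2; split; first by apply: good_putr.
  rewrite ek in h2.
  case: has_iotaP h2 => hh h2.
    case: h2 => -> ->; case: hcase => [h|[i hi [h3 h4]]|h].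
    - by constructor 1.
    - constructor 2; exists i => //; case: (ltngtP k i) hi => // hki; try lia.
      by case/negP: h3; rewrite -hki; apply/has_iotaP.
    - by constructor 3.
  constructor 3; rewrite h2; case: hcase => [/(_ _ hk) //|[i _ [_ h4]]|]; lia.
have [p [X [[lg inv] h]]] := H; exists p, X; split=> //.
case: h => //; rewrite hND => h i hi.
have := auction_sum inv; have : 0 < b by lia.
rewrite -/M => hb hs; suff : b * M.+1 < b * w by lia.
by rewrite ltn_pmul2l //; lia.
Qed.

(** * The answer *)

Lemma exec_count_half a b w c f s : market a b w c s -> a <= w -> b <= w ->
  (forall i, i < a -> f i < b) ->
  (forall i j, i < a -> j < b -> ar s aX (i * w + j) = (j == f i)) -> rg s rCNT = 0 ->
  let s' := exec count_half s in
  rg s' rCNT = \sum_(i < a) is_half (c i (f i)) /\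
  ar s' aBAD 0 = ar s aBAD 0 || has (fun i => is_incomp (c i (f i))) (iota 0 a).
Proof.
move=> mk haw hbw hf hX cnt0; cbv zeta.
rewrite -(market_A mk).
apply: (@for_rule (fun k s' => rg s' rCNT = \sum_(i < k) is_half (c i (f i)) /\
  ar s' aBAD 0 = ar s aBAD 0 || has (fun i => is_incomp (c i (f i))) (iota 0 k))) => //.
  by rewrite !storeE big_ord0 orbF.
rewrite (market_A mk) => i s1 hi ei fr fa [e1 e2].
have -> : \sum_(i0 < i.+1) is_half (c i0 (f i0)) =
    \sum_(i0 < i) is_half (c i0 (f i0)) + is_half (c i (f i)) by rewrite big_ord_recr.
rewrite has_iotaS orbA -e1 -e2 ar_putr rg_putr_ne //.
have fib : (f i < rg s1 rB) = true by rewrite fr // (market_B mk) hf.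
suff [-> ->] : rg (exec (For rJ rB (addr rI rJ ;;
    If (Rd aX rX)
      (If (Rd aHALF rX) (Op (Inc rCNT)) Skip ;; If (Rd aINC rX) fail Skip) Skip)) s1) rCNT
    = rg s1 rCNT + ((f i < rg s1 rB) && is_half (c i (f i))) /\
    ar (exec (For rJ rB (addr rI rJ ;;
    If (Rd aX rX)
      (If (Rd aHALF rX) (Op (Inc rCNT)) Skip ;; If (Rd aINC rX) fail Skip) Skip)) s1) aBAD 0
    = ar s1 aBAD 0 || ((f i < rg s1 rB) && is_incomp (c i (f i))).
  by rewrite fib.
apply: (@for_rule (fun k s' => rg s' rCNT = rg s1 rCNT + ((f i < k) && is_half (c i (f i))) /\
  ar s' aBAD 0 = ar s1 aBAD 0 || ((f i < k) && is_incomp (c i (f i))))) => //.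
  by rewrite !storeE addn0 orbF.
have -> : rg s1 rB = b by rewrite fr // (market_B mk).
move=> j s2 hj ej fr' fa' [g1 g2].
rewrite rg_putr_ne // ar_putr exec_seq.
have mk2 : market a b w c s2.
  have mk1 : market a b w c s1.
    apply: market_ext mk; rewrite ?fa // => q hq; apply: fr.
    by move: hq; rewrite !inE => /or3P[/eqP->|/eqP->|/or4P[]/eqP->].
  apply: market_ext mk1; rewrite ?fa' // => q hq; apply: fr'.
  by move: hq; rewrite !inE => /or3P[/eqP->|/eqP->|/or4P[]/eqP->].
have i2 : rg s2 rI = i by rewrite fr'.
have hX3 : rg (exec (addr rI rJ) s2) rX = i * w + j.
  by rewrite exec_addr ?i2 ?ej ?(market_W mk2) //; apply: ltnW; [apply: leq_trans haw | apply: leq_trans hbw].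
have mk3 : market a b w c (exec (addr rI rJ) s2) by apply: market_exec mk2.
have a3 A : ar (exec (addr rI rJ) s2) A = ar s2 A by apply: exec_frame_arr.
have c3 : rg (exec (addr rI rJ) s2) rCNT = rg s2 rCNT by apply: exec_frame_reg.
move: (exec (addr rI rJ) s2) hX3 mk3 a3 c3 => s3 hX3 mk3 a3 c3.
rewrite exec_if [run_test _ _]/= hX3 a3 fa' // fa // hX // ltnS leq_eqVlt [f i == j]eq_sym.
case: (j =P f i) => [ejf|_]; last by rewrite !execE c3 a3 g1 g2.
rewrite -ejf ltnn !andFb in g1 g2; rewrite -ejf orTb !andTb.
rewrite exec_seq; set s4 := exec (If (Rd aHALF rX) _ _) s3.
have e4 : s4 = if is_half (c i j) then putr s3 rCNT (rg s3 rCNT).+1 else s3.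
  by rewrite /s4 !execE [run_test _ _]/= hX3 (market_half mk3).
have [X4 c4 b4] : [/\ rg s4 rX = i * w + j, rg s4 rCNT = rg s2 rCNT + is_half (c i j) &
    forall A, ar s4 A = ar s2 A].
  by rewrite e4; case: is_half; rewrite ?storeE /= ?hX3 ?c3 ?addn1 ?addn0.
have z4 : rg s4 rZ = 0.
  by rewrite e4; case: is_half; rewrite ?storeE (market_Z mk3).
rewrite exec_if [run_test _ _]/= X4 b4 -a3 (market_inc mk3) //.
rewrite addn0 in g1; rewrite orbF in g2.
by case: is_incomp; rewrite !execE /put ?storeE ?z4 /= ?b4 c4 g1 ?g2 ?orbT ?orbF.
Qed.

Lemma exec_halve s : rg s rCNT <= rg s rA ->
  rg (exec halve s) rY1 = uphalf (rg s rCNT) /\ rg (exec halve s) rY2 = (rg s rCNT)./2.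
Proof.
move=> hle; rewrite /halve !exec_seq !exec_op /put.
set s0 := putr _ _ _.
have f0 r : r != rY1 -> r != rY2 -> rg s0 r = rg s r.
  by move=> h1 h2; rewrite !rg_putr (negPf h1) (negPf h2).
have y1 : rg s0 rY1 = 0 by rewrite !rg_putr.
have y2 : rg s0 rY2 = 0 by rewrite !rg_putr.
move: s0 f0 y1 y2 => s0 f0 y1 y2.
have hA : rg s0 rA = rg s rA by apply: f0.
rewrite -[rg s rCNT](minn_idPr hle) -hA.
apply: (@for_rule (fun k s' => rg s' rY1 = uphalf (minn k (rg s rCNT)) /\
   rg s' rY2 = (minn k (rg s rCNT))./2)) => //.
  by rewrite !storeE /= y1 y2 min0n.
move=> k s' hk ek fr fa [e1 e2].
have c1 : rg s' rCNT = rg s rCNT by rewrite fr // f0.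
rewrite !execE [run_test _ _]/= ek c1; case: ltnP => h; rewrite ?execE /put !storeE /= e1 e2.
  by rewrite (minn_idPl h) (minn_idPl (ltnW h)).
by rewrite (minn_idPr h) (minn_idPr (leqW h)).
Qed.

Lemma exec_compare x s : (forall i, ar s aIN i = nth false x i) -> rg s rLEN = size x ->
  rg s rZ = 0 -> rg s rCNT <= rg s rA ->
  let bs := drop (rg s rPOS) x in
  (rg (exec compare s) rCNT == 0) = (rg s rCNT <= binval bs) /\
  ar (exec compare s) aLAST 0 = last true bs.
Proof.
move=> hIN hlen z0 hle bs; rewrite /compare exec_seq exec_op /put.
set s0 := puta _ _ _ _.
have f0 r : rg s0 r = rg s r by rewrite rg_puta.
have IN0 i : ar s0 aIN i = nth false x i by rewrite ar_puta hIN.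
have L0 : ar s0 aLAST 0 = true by rewrite ar_puta z0.
move: s0 f0 IN0 L0 => s0 f0 IN0 L0.
set n := rg s rCNT in hle *.
pose Inv k s' := [/\ rg s' rPOS = rg s rPOS + minn k (size bs), rg s' rCNT <= rg s rA,
   (rg s' rCNT <= binval (drop k bs)) = (n <= binval bs) &
   ar s' aLAST 0 = last true (take k bs)].
suff : Inv (rg s0 rLEN) (exec (For rR rLEN (If (Lt rPOS rLEN)
    (halve ;;
     If (Rd aIN rPOS) (Op (Mov rCNT rY2) ;; Op (Wr aLAST rZ true))
                      (Op (Mov rCNT rY1) ;; Op (Wr aLAST rZ false)) ;;
     Op (Inc rPOS))
    Skip)) s0).
  have hsz : size bs <= rg s0 rLEN by rewrite f0 hlen size_drop leq_subr.
  by move=> [_ _]; rewrite drop_oversize // take_oversize // leqn0.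
apply: for_rule => //.
  by split; rewrite !storeE /= ?f0 ?min0n ?addn0 ?drop0 ?take0.
rewrite f0 hlen => k s' hk ek fr fa [e1 e2 e3 e4].
have len1 : rg s' rLEN = size x by rewrite fr // f0.
have szb : size bs = size x - rg s rPOS by rewrite size_drop.
have ltE : (rg s' rPOS < rg s' rLEN) = (k < size bs).
  by rewrite len1 e1 szb; lia.
rewrite exec_if [run_test _ _]/= ltE; case: ltnP => hkb; last first.
  rewrite execE; split; rewrite !storeE //.
  - by rewrite /= e1; lia.
  - by rewrite -e3 !drop_oversize // leqW.
  - by rewrite e4 !take_oversize // leqW.
have A1 : rg s' rA = rg s rA by rewrite fr // f0.
have hle' : rg s' rCNT <= rg s' rA by rewrite A1.
have [y1 y2] := exec_halve hle'.
rewrite exec_seq.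
have fh r : r \notin reg_mods halve -> rg (exec halve s') r = rg s' r by apply: exec_frame_reg.
have p2 := fh rPOS isT; have z2 := fh rZ isT; rewrite (fr rZ isT) f0 z0 in z2.
have a2 A : ar (exec halve s') A = ar s' A by apply: exec_frame_arr.
move: (exec halve s') y1 y2 p2 z2 a2 {fh} => s2 y1 y2 p2 z2 a2.
have bitE : ar s2 aIN (rg s2 rPOS) = nth false bs k.
  by rewrite a2 fa // IN0 p2 e1 (minn_idPl (ltnW hkb)) nth_drop.
have dropE : drop k bs = nth false bs k :: drop k.+1 bs by rewrite (drop_nth false).
have takeE : take k.+1 bs = rcons (take k bs) (nth false bs k) by rewrite (take_nth false).
rewrite !execE [run_test _ _]/= bitE.
rewrite dropE /= in e3.
case: (nth false bs k) e3 takeE => e3 takeE; rewrite /put; split; rewrite !storeE /=.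
- by rewrite p2 e1; lia.
- by rewrite y2; lia.
- by rewrite y2 -e3; lia.
- by rewrite z2 takeE last_rcons.
- by rewrite p2 e1; lia.
- by rewrite y1; lia.
- by rewrite y1 -e3; lia.
- by rewrite z2 takeE last_rcons.
Qed.

Lemma exec_read_sign s : rg s rZ = 0 ->
  let s' := exec read_sign s in
  rg s' rPOS = (rg s rPOS).+1 /\
  ar s' aBAD 0 = [|| ar s aBAD 0, ~~ (rg s rPOS < rg s rLEN) | ar s aIN (rg s rPOS)].
Proof.
move=> z0; cbv zeta; rewrite /read_sign !exec_seq.
set s1 := exec (If (Lt _ _) _ _) s.
have [h1 h2 h3 h4] : [/\ rg s1 rPOS = rg s rPOS, rg s1 rZ = 0,
    ar s1 aBAD 0 = ar s aBAD 0 || ~~ (rg s rPOS < rg s rLEN) & ar s1 aIN = ar s aIN].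
  split; [by rewrite exec_frame_reg|by rewrite exec_frame_reg| |by rewrite exec_frame_arr].
  by rewrite /s1 !execE [run_test _ _]/=; case: ifP; rewrite /put ?storeE ?z0 /= ?orbF ?orbT.
move: s1 h1 h2 h3 h4 => s1 h1 h2 h3 h4.
rewrite !execE [run_test _ _]/= h1 h4 /put !storeE [_ == _]/= orbA -h3.
by case: (ar s aIN _); rewrite ?storeE ?h1 ?h2 /= ?orbT ?orbF.
Qed.

Lemma full_choice a b X : full a b X ->
  exists f : nat -> nat, forall i, i < a -> f i < b /\ X i (f i).
Proof.
move=> h; exists (fun i => find (X i) (iota 0 b)) => i hi.
have hh : has (X i) (iota 0 b) by apply/has_iotaP; apply: h.
have hlt : find (X i) (iota 0 b) < b by move: hh; rewrite has_find size_iota.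
by split=> //; have := nth_find 0 hh; rewrite nth_iota.
Qed.

Lemma exec_auction_count a b w c s : let M := a.+1 * a.+1 in
  market a b w c s -> rg s rND = b * w -> rg s rCNT = 0 ->
  (forall i, ar s aP i = false) -> (forall i, ar s aX i = false) ->
  a <= b -> b <= w -> 2 * M + 1 < w ->
  let s' := exec count_half (exec auction s) in
  rg s' rCNT <= a /\ exists bad : bool,
    ar s' aBAD 0 = ar s aBAD 0 || bad /\
    forall h, (exists g, good_injection a b c h g) <-> ~~ bad /\ rg s' rCNT <= h.
Proof.
move=> M mk hND hcnt hP hX hab hbw hw; cbv zeta.
have [p [X [lg inv hfull]]] := exec_auction mk hND hP hX hab hbw hw.
have mk1 : market a b w c (exec auction s) by apply: market_exec mk.
have c1 : rg (exec auction s) rCNT = 0 by rewrite exec_frame_reg.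
have b1 : ar (exec auction s) aBAD = ar s aBAD by apply: exec_frame_arr.
move: (exec auction s) lg mk1 c1 b1 => s1 lg mk1 c1 b1.
have [f hf] := full_choice hfull.
have haw : a <= w by apply: leq_trans hbw.
have fX i j : i < a -> j < b -> ar s1 aX (i * w + j) = (j == f i).
  move=> hi hj; rewrite lg.2 //; have [hfi hXi] := hf i hi.
  apply/idP/eqP => [h|-> //]; exact: (auction_fun inv hi hj hfi h hXi).
have [|eC eB] := exec_count_half mk1 haw hbw _ fX c1; first by move=> i /hf[].
split.
  rewrite eC -[X in _ <= X](card_ord a) -sum1_card; apply: leq_sum => i _.
  by case: is_half.
exists (has (fun i => is_incomp (c i (f i))) (iota 0 a)); split; first by rewrite eB b1.
move=> h; rewrite eC.
have finj : injection a b f.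
  split=> [i /hf[] //|i i' hi hi' e].
  have [h1 h2] := hf i hi; have [h3 h4] := hf i' hi'.
  by apply: (auction_inj inv hi hi' h1 h2); rewrite e.
rewrite (@auction_decides a b c p f h finj); first 1 last.
- move=> i k hi hk; have [h1 h2] := hf i hi.
  exact: (auction_slack inv hi h1 hk h2).
- move=> j hj hp; have [i hi hXi] := auction_owned inv hj hp; exists i => //.
  have [h1 h2] := hf i hi; exact: (auction_fun inv hi h1 hj h2 hXi).
split=> [[_ h1 h2]|[h1 h2]].
  split=> //; apply/negP => /has_iotaP[i hi hc].
  by have := h1 i hi; rewrite hc.
split=> // i hi; apply: contra h1 => hc; apply/has_iotaP; by exists i.
Qed.

Lemma program_correct x :
  run_test (Rd aACC rZ) (exec program (init_store x)) <-> allKEI_lang x.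
Proof.
rewrite allKEI_langP.
rewrite /program (exec_seq read_header) (exec_seq set_sizes) (exec_seq set_square).
rewrite (exec_seq set_width) (exec_seq set_rounds).
have prep := exec_prepare x.
set s0 := exec set_rounds _ in prep *; move: s0 prep => s0 prep.
rewrite /decide (exec_seq read_matrix) (exec_seq read_sign) (exec_seq auction).
rewrite (exec_seq count_half) (exec_seq compare).
set a := dec_np x + dec_na x; set b := dec_np x + dec_nb x; set w := dec_width x.
have haw : a <= w by rewrite /w /dec_width -/a; lia.
have hbw : b <= w by rewrite /w /dec_width -/b; lia.
have hw : 2 * (a.+1 * a.+1) + 1 < w by rewrite /w /dec_width /dec_square -/a -/b; lia.
have arr0 A i : A \in [:: 2; 4; 5; 6; 7; 8; 9] -> ar s0 A i = false.
  by move=> hA; apply: (prep_arr prep); apply: contraTneq hA => ->.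
have [m1 m2 m3 m4] := exec_read_matrix (prep_IN prep) (prep_Z prep) (prep_W prep)
  (prep_A prep) (prep_B prep) haw hbw (fun i => arr0 5 i isT) (fun i => arr0 4 i isT).
rewrite -/a -/b -/w (prep_POS prep) in m1 m2 m3 m4.
have fr1 r : r \notin reg_mods read_matrix -> rg (exec read_matrix s0) r = rg s0 r.
  exact: exec_frame_reg.
have fa1 A : A \notin arr_mods read_matrix -> ar (exec read_matrix s0) A = ar s0 A.
  exact: exec_frame_arr.
move: (exec read_matrix s0) m1 m2 m3 m4 fr1 fa1 => s1 m1 m2 m3 m4 fr1 fa1.
have lt_ab i j : i < a -> j < b -> i * b + j < a * b by nia.
have mk1 : market a b w (dec_entry x) s1.
  split; rewrite ?fr1 //.
  - exact: prep_Z prep.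
  - exact: prep_A prep.
  - exact: prep_B prep.
  - exact: prep_S1 prep.
  - exact: prep_S2 prep.
  - exact: prep_W prep.
  - move=> i j hi hj; rewrite m3 // lt_ab // /dec_entry /dec_pos -/b.
    by case: (nth _ _ (_ + _)) => //; case: (nth _ _ _.+1).
  - move=> i j hi hj; rewrite m2 // lt_ab // /dec_entry /dec_pos -/b.
    by case: (nth _ _ (_ + _)) => //; case: (nth _ _ _.+1).
have z1 : rg s1 rZ = 0 by rewrite (market_Z mk1).
have [p2 b2] := exec_read_sign z1.
rewrite m1 -/(dec_end x) (fr1 rLEN isT) (prep_LEN prep) (fa1 aIN isT) (prep_IN prep) in p2 b2.
have mk2 : market a b w (dec_entry x) (exec read_sign s1) by apply: market_exec mk1.
have fr2 r : r \notin [:: rPOS] -> rg (exec read_sign s1) r = rg s1 r.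
  by move=> hr; rewrite exec_frame_reg.
have fa2 A : A != aBAD -> ar (exec read_sign s1) A = ar s1 A.
  by move=> hA; rewrite exec_frame_arr //= !inE (negPf hA).
move: (exec read_sign s1) p2 b2 mk2 fr2 fa2 => s2 p2 b2 mk2 fr2 fa2.
set s4 := exec count_half (exec auction s2).
have mk4 : market a b w (dec_entry x) s4 by apply/market_exec/market_exec.
have fr4 r : r \notin reg_mods (auction ;; count_half) -> rg s4 r = rg s2 r.
  by rewrite /s4 -exec_seq; apply: exec_frame_reg.
have fa4 A : A \notin arr_mods (auction ;; count_half) -> ar s4 A = ar s2 A.
  by rewrite /s4 -exec_seq; apply: exec_frame_arr.
have fr5 r : r \notin reg_mods compare -> rg (exec compare s4) r = rg s4 r by apply: exec_frame_reg.
have fa5 A : A \notin arr_mods compare -> ar (exec compare s4) A = ar s4 A by apply: exec_frame_arr.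
have acc5 i : ar (exec compare s4) aACC i = false.
  by rewrite fa5 // fa4 // fa2 // fa1 // arr0.
have mk5 : market a b w (dec_entry x) (exec compare s4) by apply: market_exec.
have accE : run_test (Rd aACC rZ) (exec verdict (exec compare s4)) =
  [&& a <= b, ~~ ar s4 aBAD 0, ar (exec compare s4) aLAST 0 & rg (exec compare s4) rCNT == 0].
  have -> : ar s4 aBAD = ar (exec compare s4) aBAD by rewrite fa5.
  have z5 := market_Z mk5; have A5 := market_A mk5; have B5 := market_B mk5.
  move: (exec compare s4) acc5 z5 A5 B5 => s5 acc5 z5 A5 B5.
  have tLt : run_test (Lt rB rA) s5 = (b < a) by rewrite /= A5 B5.
  have tRd A : run_test (Rd A rZ) s5 = ar s5 A 0 by rewrite /= z5.
  have tEq : run_test (Eq rCNT rZ) s5 = (rg s5 rCNT == 0) by rewrite /= z5.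
  rewrite /verdict !execE tLt !tRd tEq; case: ltnP => _; first by rewrite tRd acc5.
  case: (ar s5 aBAD 0); first by rewrite tRd acc5.
  case: (ar s5 aLAST 0); last by rewrite tRd acc5.
  case: (rg s5 rCNT == 0); last by rewrite tRd acc5.
  by rewrite /= !storeE z5.
rewrite accE.
case: (leqP a b) => hab; last first.
  split=> // -[_ [f [[hf1 hf2] _ _]]].
  pose F (i : 'I_a) : 'I_b := Ordinal (hf1 i (ltn_ord i)).
  have : injective F.
    by move=> i i' /(congr1 val) e; apply/val_inj/(hf2 _ _ (ltn_ord i) (ltn_ord i') e).
  by move/leq_card; rewrite !card_ord leqNgt hab.
have [|||| hle [bad [hbad hdec]]] := exec_auction_count mk2 _ _ _ _ hab hbw hw.
- by rewrite fr2 // fr1 // (prep_ND prep).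
- by rewrite fr2 // fr1 // (prep_CNT prep).
- by move=> i; rewrite fa2 // fa1 // arr0.
- by move=> i; rewrite fa2 // fa1 // arr0.
rewrite -/s4 in hle hbad hdec.
have [|||| hcmp hlast] := @exec_compare x s4.
- by move=> i; rewrite fa4 // fa2 // fa1 // (prep_IN prep).
- by rewrite fr4 // fr2 // fr1 // (prep_LEN prep).
- exact: market_Z mk4.
- by rewrite (market_A mk4).
rewrite (fr4 rPOS isT) p2 -/(dec_bound x) in hcmp hlast.
rewrite hcmp hlast hbad b2 hdec /=.
rewrite !negb_or negbK -!andbA.
split.
  case/and5P=> h1 h2 h3 h4 /andP[h5 h6]; split=> //.
  have [h7 h8] := m4.1 h1.
  move: h7; rewrite (prep_BAD prep) negbK => /and3P[l1 l2 l3].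
  by split=> // i j hi hj; apply: h8 => //; apply: lt_ab.
case=> -[[l1 l2 l3] h8 h2 h3 h5] [h4 h6]; rewrite h2 h3 h4 h5 h6 !andbT.
apply/m4.2; split; first by rewrite (prep_BAD prep) l1 l2 l3.
by move=> i j hi hj _; apply: h8.
Qed.

Theorem theorem2 : poly_time_decidable allKEI_lang.
Proof.
exact: poly_time_decidable_cmd program_ok program_polytime program_correct.
Qed.
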